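(* Let $H$ be an ordered graph on $h$ vertices with $\chi_<(H)\geq 3$ and let $\eta>0$. If $H$ does not have a local barrier and $\chi^*_{cr}(H)<\chi_<(H)$, then there exist $n_0\in\mathbb N$ and $\nu$ with $0<\nu<\eta$ such that the following holds. If $G$ is an ordered graph on $n\geq n_0$ vertices with $\delta(G)\geq\left(1-\frac{1}{\chi_<(H)-1}+\eta\right)n$, then $V(G)=[n]$ contains a set $Abs$ with $|Abs|\leq\nu n$ such that $Abs$ is an $H$-absorbing set for every $W\subseteq V(G)\setminus Abs$ with $|W|\in h\mathbb N$ and $|W|\leq\nu^3 n$.
   Context: An ordered graph on $h$ vertices is a graph with vertex set $[h]$ (ordered naturally). An ordered graph $G$ on $[n]$ contains an ordered graph $H$ on $[h]$ if there is an injection $\phi:[h]\to[n]$ with $\phi(i)<\phi(j)$ for $i<j$ and $\phi(i)\phi(j)\in E(G)$ whenever $ij\in E(H)$; the image is a copy of $H$. An $H$-tiling is a collection of vertex-disjoint copies of $H$; it is perfect if it covers all vertices. For a set $S\subseteq V(G)$, $G[S]$ is the induced subgraph. Given $W\subseteq V(G)$, a set $S\subseteq V(G)$ is an $H$-absorbing set for $W$ if both $G[S]$ and $G[W\cup S]$ contain perfect $H$-tilings. For sets of integers, $X<Y$ means $a<b$ for all $a\in X,b\in Y$. An interval $r$-colouring of $H$ is a partition of $[h]$ into $r$ intervals $V_1<\dots<V_r$ (some possibly empty) with no edge inside an interval; $\chi_<(H)$ is the least such $r$. $H$ (with $r:=\chi_<(H)\ge2$) has a local barrier if there exist fixed $i\neq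 j\in[r+1]$ such that for every interval $(r+1)$-colouring $V_1<\dots<V_{r+1}$ of $H$ with $V_i=\{v\}$ a singleton, there is an edge of $H$ between $v$ and $V_j$. Bottlegraphs: for a complete $k$-partite unordered graph $B$ with parts $U_1,\dots,U_k$ and a permutation $\sigma$ of $[k]$, an interval labelling w.r.t. $\sigma$ is a bijection $\phi:V(B)\to[|B|]$ with $\phi(U_i)<\phi(U_j)$ when $\sigma(i)<\sigma(j)$; the ordered blow-up $(B(t),\phi)$ replaces each vertex $x$ by $t$ independent vertices $V_x$ (complete bipartite between $V_x,V_y$ when $xy\in E(B)$) ordered so that $V_x<V_y$ when $\phi(x)<\phi(y)$. $B$ is a bottlegraph of $H$ if for every such $\sigma,\phi$ some $(B(t),\phi)$ contains a perfect $H$-tiling. $\chi_{cr}(F)=(\chi(F)-1)|F|/(|F|-\sigma(F))$ with $\sigma(F)$ the least size of a colour class over proper $\chi(F)$-colourings, and $\chi^*_{cr}(H)=\inf\{\chi_{cr}(B): B \text{ a bottlegraph of } H\}$. *)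

(* Defs.v *)
From mathcomp Require Import all_boot all_order all_algebra all_fingroup.
From mathcomp Require Import boolp classical_sets reals.
(* Imported last so that set0, partition, ... refer to {set T}, not to set T. *)
From mathcomp Require Import finset.

Set Implicit Arguments.
Unset Strict Implicit.
Unset Printing Implicit Defensive.

Import Order.TTheory GRing.Theory Num.Theory.

(* Finite simple graphs on [n], with [n] encoded as 'I_n (0-based).  The same
   type serves for ordered graphs (notions using the order of 'I_n) and for
   unordered ones (notions invariant under relabelling). *)
Record graph (n : nat) := Graph {
  edge :> rel 'I_n;
  edge_sym : symmetric edge;
  edge_irrefl : irreflexive edge }.

Definition min_degree n (G : graph n) : nat :=
  \big[minn/n]_(v : 'I_n) #|[set w | G v w]|.

(** Copies and tilings *)

Definition is_copy h n (H : graph h) (G : graph n) (A : {set 'I_n}) : Prop :=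
  exists phi : 'I_h -> 'I_n,
    [/\ forall i j : 'I_h, i < j -> phi i < phi j,
        forall i j : 'I_h, H i j -> G (phi i) (phi j)
      & A = phi @: [set: 'I_h]].

(* The copies of H in G[S] are the copies of H in G whose vertices lie in S,
   so this says that G[S] has a perfect H-tiling.  For S = set0 the empty
   tiling is perfect. *)
Definition has_perfect_tiling h n (H : graph h) (G : graph n)
    (S : {set 'I_n}) : Prop :=
  exists2 P : {set {set 'I_n}},
    partition P S & forall A, A \in P -> is_copy H G A.

Definition absorbing h n (H : graph h) (G : graph n) (S W : {set 'I_n}) : Prop :=
  has_perfect_tiling H G S /\ has_perfect_tiling H G (W :|: S).

(** Interval colourings *)

Definition set_lt n (X Y : {set 'I_n}) : bool :=
  [forall a in X, forall b in Y, a < b].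

(* Covering 'I_h by sets V_0 < ... < V_(r-1) forces these to be pairwise
   disjoint and to be intervals; empty ones are allowed. *)
Definition interval_colouring h (H : graph h) r
    (V : {ffun 'I_r -> {set 'I_h}}) : bool :=
  [&& [forall x, exists i, x \in V i],
      [forall i : 'I_r, forall j : 'I_r, (i < j) ==> set_lt (V i) (V j)]
    & [forall i, forall x in V i, forall y in V i, ~~ H x y]].

Lemma interval_colourable h (H : graph h) :
  exists r, [exists V : {ffun 'I_r -> {set 'I_h}}, interval_colouring H V].
Proof.
exists h; apply/existsP; exists [ffun i => [set i]]; apply/and3P; split.
- by apply/forallP => x; apply/existsP; exists x; rewrite ffunE set11.
- apply/forallP => i; apply/forallP => j; apply/implyP => lt_ij.
  apply/forall_inP => a; rewrite ffunE => /set1P ->.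
  by apply/forall_inP => b; rewrite ffunE => /set1P ->.
- apply/forallP => i; apply/forall_inP => a; rewrite ffunE => /set1P ->.
  by apply/forall_inP => b; move=> /set1P ->; rewrite edge_irrefl.
Qed.

Definition interval_chromatic h (H : graph h) : nat :=
  ex_minn (interval_colourable H).

Definition local_barrier h (H : graph h) : Prop :=
  exists i j : 'I_(interval_chromatic H).+1, i != j /\
    forall (V : {ffun 'I_(interval_chromatic H).+1 -> {set 'I_h}}) (v : 'I_h),
      interval_colouring H V -> V i = [set v] -> exists2 w, w \in V j & H v w.

(** Chromatic number and critical chromatic number of unordered graphs *)

Definition proper_colouring m (F : graph m) r (c : {ffun 'I_m -> 'I_r}) : bool :=
  [forall x, forall y, F x y ==> (c x != c y)].

Lemma colourable m (F : graph m) :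
  exists r, [exists c : {ffun 'I_m -> 'I_r}, proper_colouring F c].
Proof.
exists m; apply/existsP; exists [ffun x => x].
apply/forallP => x; apply/forallP => y; apply/implyP => Fxy.
by rewrite !ffunE; apply/eqP => xy; rewrite xy edge_irrefl in Fxy.
Qed.

Definition chromatic m (F : graph m) : nat := ex_minn (colourable F).

(* The default value m of the minimum bounds every class size, so it does not
   affect the minimum. *)
Definition min_colour_class m (F : graph m) : nat :=
  \big[minn/m]_(c : {ffun 'I_m -> 'I_(chromatic F)} | proper_colouring F c)
    \big[minn/m]_(i < chromatic F) #|[set x | c x == i]|.

Definition chi_cr (R : realType) m (F : graph m) : R :=
  (((chromatic F)%:R - 1) * m%:R / (m%:R - (min_colour_class F)%:R))%R.

(** Bottlegraphs *)

Definition complete_multipartite m (B : graph m) k (U : 'I_k -> {set 'I_m}) : Prop :=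
  [/\ forall i, U i != set0,
      forall x, exists i, x \in U i,
      forall i j, i != j -> [disjoint U i & U j]
    & forall i j x y, x \in U i -> y \in U j -> B x y = (i != j)].

Definition interval_labelling m k (U : 'I_k -> {set 'I_m})
    (sigma : {perm 'I_k}) (phi : {perm 'I_m}) : Prop :=
  forall i j : 'I_k, sigma i < sigma j -> set_lt (phi @: U i) (phi @: U j).

Lemma block_subproof m t (a : 'I_(m * t)) : a %/ t < m.
Proof.
case: t a => [|t] a; last by rewrite ltn_divLR.
by case: a => a lt_a; exfalso; rewrite muln0 in lt_a.
Qed.

Definition block m t (a : 'I_(m * t)) : 'I_m := Ordinal (block_subproof a).

(* (B(t), phi): the block V_x consists of the t consecutive vertices a of
   [m * t] with a %/ t = phi x. *)
Definition blowup_edge m (B : graph m) t (phi : {perm 'I_m}) : rel 'I_(m * t) :=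
  fun a b => B ((phi^-1)%g (block a)) ((phi^-1)%g (block b)).

Lemma blowup_sym m (B : graph m) t phi : symmetric (@blowup_edge m B t phi).
Proof. by move=> a b; rewrite /blowup_edge edge_sym. Qed.

Lemma blowup_irrefl m (B : graph m) t phi : irreflexive (@blowup_edge m B t phi).
Proof. by move=> a; rewrite /blowup_edge edge_irrefl. Qed.

Definition blowup m (B : graph m) t phi : graph (m * t) :=
  Graph (@blowup_sym m B t phi) (@blowup_irrefl m B t phi).

(* Parts are nonempty and k, t are positive: the empty graph, or an empty
   blow-up, would trivially have a perfect H-tiling. *)
Definition bottlegraph h (H : graph h) m (B : graph m) : Prop :=
  exists k (U : 'I_k -> {set 'I_m}),
    [/\ 0 < k, complete_multipartite B U
      & forall (sigma : {perm 'I_k}) (phi : {perm 'I_m}),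
          interval_labelling U sigma phi ->
          exists2 t, 0 < t & has_perfect_tiling H (blowup B t phi) [set: 'I_(m * t)]].

(* For 0 < h this set is nonempty (it contains the value at the complete graph
   on [h]) and bounded below by 0, so the default value of inf is irrelevant. *)
Definition chi_cr_star (R : realType) h (H : graph h) : R :=
  inf [set x : R | exists m (B : graph m), bottlegraph H B /\ x = chi_cr R B]%classic.

(* Main.v *)
(** Only the following consequence of the degree condition is used: any
    [q = r - 1] vertices, where [r] is the interval chromatic number of [H],
    have at least [n / K] common neighbours.

    Every interval [r]-colouring of [H] embeds [H] into an ordered blow-up of a
    complete graph on [r] vertices.  As the critical chromatic number is less
    than [r], some bottlegraph has exactly [r] parts, not all of the same size;
    permuting them shows that no boundary between two consecutive classes is
    the same in all interval colourings of [H].  Hence for each [i] there are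
    two interval colourings differing in one vertex only, which is moved
    between the classes [i] and [i + 1], and so any two vertices of a blow-up
    of a complete graph on [r] vertices are exchangeable: a few further
    vertices together with either of them have a perfect tiling.  The absence
    of local barriers extends this to every vertex that is adjacent to all but
    one part of the blow-up.

    Given [W] of size [h], one finds greedily, in many ways, a clique [U] and
    for each [w] in [W] two more cliques chaining [w] to [U]: one all of whose
    vertices but one are adjacent to [w], and one meeting both this clique and
    [U].  By Markov's inequality the whole configuration, together with its
    order type, may be blown up, still in many ways.  In the blow-up [U]
    contains a copy of [H] whose vertices are exchangeable with those of [W],
    which gives an absorber.

    The absorbing set is a union of disjoint absorbers chosen one by one so as
    to decrease the potential summing, over the sets [W], the number 2 to the
    minus number of absorbers chosen for [W]. *)

Require Import Defs.
From mathcomp Require Import all_boot all_order all_algebra all_fingroup.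
From mathcomp Require Import boolp classical_sets reals.
From mathcomp Require Import fintype finset.
From mathcomp Require Import zify ring lra.

Set Implicit Arguments.
Unset Strict Implicit.
Unset Printing Implicit Defensive.

Import Order.TTheory GRing.Theory Num.Theory.

(** * Dense predicates *)

(** The density is recorded by its inverse [c], a natural number, so that losses multiply and never
    depend on the size of [T]. *)
Definition many (c : nat) (T : finType) (P : T -> Prop) : Prop :=
  #|T| <= c * #|[set x | `[< P x >]]|.

Lemma many_sub (c c' : nat) (T : finType) (P Q : T -> Prop) :
  c <= c' -> (forall x, P x -> Q x) -> many c P -> many c' Q.
Proof.
move=> cc' PQ /leq_trans; apply; apply: leq_mul => //.
apply: subset_leq_card; apply/subsetP => x; rewrite !inE => /asboolP Px.
by apply/asboolP; apply: PQ.
Qed.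

Lemma many_ex (c : nat) (T : finType) (P : T -> Prop) :
  0 < #|T| -> many c P -> exists x, P x.
Proof.
move=> T0; rewrite /many; have [-> | ] := set_0Vmem [set x | `[< P x >]].
  by rewrite cards0 muln0 leqNgt T0.
by case=> x; rewrite inE => /asboolP Px _; exists x.
Qed.

Lemma many_all (T : finType) (P : T -> Prop) : (forall x, P x) -> many 1 P.
Proof.
move=> allP; rewrite /many mul1n -cardsT; apply: subset_leq_card.
by apply/subsetP => x _; rewrite inE; apply/asboolP.
Qed.

Lemma card_fibres (T U : finType) (P : T -> U -> Prop) :
  #|[set z : T * U | `[< P z.1 z.2 >]]| =
  \sum_x #|[set y | `[< P x y >]]|.
Proof.
rewrite -sum1_card.
rewrite (eq_bigl (fun z : T * U => (true && `[< P z.1 z.2 >]))); last first.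
  by move=> z; rewrite inE.
rewrite -(@pair_big_dep _ _ _ _ _ xpredT (fun x y => `[< P x y >]) (fun _ _ => 1)) /=.
apply: eq_bigr => x _; rewrite sum1_card; apply: eq_card => y.
by rewrite inE.
Qed.

Lemma many_pair (c d : nat) (T U : finType) (P : T -> U -> Prop) :
  many c (fun x => many d (P x)) -> many (c * d) (fun z : T * U => P z.1 z.2).
Proof.
rewrite /many card_fibres card_prod => cT.
have cTU := leq_mul cT (leqnn #|U|).
apply: leq_trans cTU _; rewrite -!mulnA leq_mul2l; apply/orP; right.
rewrite big_distrr /= -sum_nat_const big_mkcond /=.
apply: leq_sum => x _; rewrite inE.
by case: ifP => // /asboolP.
Qed.

(** Markov's inequality: the rows that are not good contribute at most half of the guaranteed pairs,
    so the good rows, with at most [#|U|] pairs each, must account for the other half. *)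
Lemma many_unpair (c : nat) (T U : finType) (P : T -> U -> Prop) :
  0 < #|U| -> many c (fun z : T * U => P z.1 z.2) ->
  many (2 * c) (fun x => many (2 * c) (P x)).
Proof.
move=> U0; rewrite /many card_fibres card_prod.
set good := [set x | _] => cTU.
have bound x : 2 * c * #|[set y | `[< P x y >]]| <=
    (if x \in good then 2 * c * #|U| else 0) + #|U|.
  case: ifP => [_ | /negbT].
    by apply: leq_trans (leq_addr _ _); rewrite leq_mul2l max_card orbT.
  by rewrite inE add0n => /asboolPn/negP; rewrite -ltnNge => /ltnW.
have /(leq_mul (leqnn 2)) := cTU; rewrite !mulnA big_distrr /= => h1.
have /(leq_trans h1) : \sum_x 2 * c * #|[set y | `[< P x y >]]| <=
    \sum_x ((if x \in good then 2 * c * #|U| else 0) + #|U|).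
  by apply: leq_sum => x _; apply: bound.
rewrite big_split /= -big_mkcond /= !sum_nat_const.
rewrite mul2n -addnn mulnDl leq_add2r mulnA leq_pmul2r //.
by rewrite (mulnC #|_|).
Qed.

Lemma many_swap (c : nat) (T U : finType) (P : T -> U -> Prop) :
  many c (fun z : T * U => P z.1 z.2) ->
  many c (fun z : U * T => P z.2 z.1).
Proof.
rewrite /many !card_prod (mulnC #|T|) => /leq_trans; apply.
rewrite leq_mul2l; apply/orP; right.
have inj : injective (fun z : T * U => (z.2, z.1)) by move=> [a b] [a' b'] [-> ->].
rewrite -(card_imset _ inj); apply: subset_leq_card.
by apply/subsetP => _ /imsetP[z + ->]; rewrite !inE.
Qed.

(* A coordinate of [U] with values in [T], given by its reading and writing
   functions. *)
Definition lens (T U : Type) (get : U -> T) (put : T -> U -> U) : Prop :=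
  [/\ forall y u, get (put y u) = y,
      forall u, put (get u) u = u
    & forall y y' u, put y (put y' u) = put y u].

(** Exchanging the stored value with the outside one is an involution of [T * U], and it carries the
    left-hand set onto a full product. *)
Lemma card_lens (T U : finType) (get : U -> T) (put : T -> U -> U)
    (P : U -> Prop) : lens get put ->
  #|[set z : T * U | `[< P (put z.1 z.2) >]]| = #|T| * #|[set u | `[< P u >]]|.
Proof.
move=> [gp pg pp].
pose g (z : T * U) := (get z.2, put z.1 z.2).
have gK : involutive g by case=> y u; rewrite /g /= gp pp pg.
have -> : [set z : T * U | `[< P (put z.1 z.2) >]] =
    g @^-1: setX [set: T] [set u | `[< P u >]].
  by apply/setP => z; rewrite !inE.
by rewrite card_preimset ?cardsX ?cardsT //; apply: inv_inj.
Qed.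

(** Splits off one coordinate as an independent variable at no cost in density, so that it can be
    chosen or blown up on its own. *)
Lemma many_lens (c : nat) (T U : finType) (get : U -> T) (put : T -> U -> U)
    (P : U -> Prop) : lens get put -> 0 < #|T| ->
  many c P <-> many c (fun z : T * U => P (put z.1 z.2)).
Proof.
move=> L T0; rewrite /many (card_lens P L) card_prod mulnCA.
by rewrite leq_pmul2l.
Qed.

Definition put_ffun (I T : finType) (a : I) (y : T) (x : {ffun I -> T}) :
  {ffun I -> T} := [ffun b => if b == a then y else x b].

Lemma lens_ffun (I T : finType) (a : I) :
  lens (fun x : {ffun I -> T} => x a) (put_ffun a).
Proof.
split=> [y x | x | y y' x]; first by rewrite ffunE eqxx.
  by apply/ffunP => b; rewrite ffunE; case: eqP => [-> |].
by apply/ffunP => b; rewrite !ffunE; case: eqP.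
Qed.

Lemma lens_fst (T U V : Type) (get : U -> T) (put : T -> U -> U) :
  lens get put ->
  lens (fun z : U * V => get z.1) (fun y z => (put y z.1, z.2)).
Proof.
move=> [gp pg pp]; split=> [y z | [u v] | y y' z] /=; first exact: gp.
  by rewrite pg.
by rewrite pp.
Qed.

Lemma lens_snd (T U V : Type) (get : U -> T) (put : T -> U -> U) :
  lens get put ->
  lens (fun z : V * U => get z.2) (fun y z => (z.1, put y z.2)).
Proof.
move=> [gp pg pp]; split=> [y z | [u v] | y y' z] /=; first exact: gp.
  by rewrite pg.
by rewrite pp.
Qed.

Lemma lens_comp (T U V : Type) (get : U -> T) (put : T -> U -> U)
    (get' : V -> U) (put' : U -> V -> V) :
  lens get put -> lens get' put' ->
  lens (fun z => get (get' z)) (fun y z => put' (put y (get' z)) z).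
Proof.
move=> [gp pg pp] [gp' pg' pp']; split=> [y z | z | y y' z] /=.
- by rewrite gp' gp.
- by rewrite pg pg'.
- by rewrite gp' pp' pp.
Qed.

Lemma expn_ffact (d t : nat) : (d - t) ^ t <= d ^_ t.
Proof.
elim: t d => [|t IH] d //; case: d => [|d]; first by rewrite sub0n exp0n.
rewrite ffactSS expnS; apply: leq_mul; first by rewrite leq_subLR; lia.
by rewrite subSS; apply: IH.
Qed.

(** If [d] points satisfy [P], the size condition gives [2 * t <= d], so each of the [t] values can
    still be picked in at least [d - t >= d / 2] ways; hence the factor 2 per value. *)
Lemma many_injective (c t : nat) (T : finType) (P : T -> Prop) :
  0 < #|T| -> 2 * c * t <= #|T| -> many c P ->
  many ((2 * c) ^ t) (fun f : {ffun 'I_t -> T} =>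
    injective f /\ forall i, P (f i)).
Proof.
rewrite /many => T0 tT cT; set D := [set x | _] in cT.
have cpos : 0 < c by case: (c) cT => //; rewrite mul0n leqNgt T0.
have tD : 2 * t <= #|D|.
  have := leq_trans tT cT; rewrite (mulnC 2) -mulnA leq_pmul2l //.
rewrite card_ffun card_ord.
apply: (@leq_trans ((2 * c) ^ t * #|D| ^_ t)).
  apply: (@leq_trans ((2 * c * (#|D| - t)) ^ t)).
    have leX (a b : nat) : a <= b -> a ^ t <= b ^ t.
      by case: (posnP t) => [-> //|t0]; rewrite leq_exp2r.
    apply: leX; apply: leq_trans cT _.
    by rewrite (mulnC 2) -mulnA leq_mul2l; apply/orP; right; lia.
  by rewrite expnMn leq_mul2l expn_ffact orbT.
rewrite leq_mul2l; apply/orP; right.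
rewrite -[X in _ ^_ X](card_ord t) -(card_inj_ffuns_on _ (mem D)).
apply: subset_leq_card; apply/subsetP => f; rewrite !inE => /andP[/ffun_onP fD /injectiveP fi].
apply/asboolP; split=> // i.
by have := fD i; rewrite inE => /asboolP.
Qed.

(** Markov's inequality finds many [u] with many good partners; over each such [u] the partners are
    chosen injectively. It costs a factor 2 for [u] and another one for each partner. *)
Lemma many_blow (c t : nat) (T U : finType) (P : T -> U -> Prop) :
  0 < #|T| -> 4 * c * t <= #|T| -> many c (fun z : T * U => P z.1 z.2) ->
  many (2 * c * (4 * c) ^ t) (fun z : {ffun 'I_t -> T} * U =>
    injective z.1 /\ forall i, P (z.1 i) z.2).
Proof.
move=> T0 tT /many_swap /(@many_unpair c U T (fun u x => P x u) T0) mP.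
apply: (@many_swap _ _ _ (fun u (f : {ffun 'I_t -> T}) =>
  injective f /\ forall i, P (f i) u)).
apply: (@many_pair (2 * c) ((4 * c) ^ t) _ _ (fun u (f : {ffun 'I_t -> T}) =>
  injective f /\ forall i, P (f i) u)).
apply: many_sub mP => // u mu.
have := many_injective T0 _ mu; rewrite mulnA; exact.
Qed.

Lemma many_drop (c : nat) (T U : finType) (P : U -> Prop) :
  0 < #|T| -> 0 < #|U| -> many c (fun z : T * U => P z.2) -> many (2 * c) P.
Proof.
by move=> T0 U0 /(@many_unpair c T U (fun=> P) U0) /(many_ex T0)[].
Qed.

(* Coordinates are blown up one after the other: the first component carries
   the coordinates not yet blown up, the second one the classes already built. *)
Lemma many_blowup (I : finType) (t c : nat) : 0 < t ->
  exists c' N : nat, forall (T : finType) (P : {ffun I -> T} -> Prop),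
    N < #|T| -> many c P ->
    many c' (fun Z : {ffun I -> {ffun 'I_t -> T}} =>
      (forall a, injective (Z a)) /\
      forall s : I -> 'I_t, P [ffun a => Z a (s a)]).
Proof.
move=> t0.
pose Q (T : finType) (P : {ffun I -> T} -> Prop) (S : seq I)
    (z : {ffun I -> T} * {ffun I -> {ffun 'I_t -> T}}) :=
  (forall a, a \in S -> injective (z.2 a)) /\
  forall s : I -> 'I_t, P [ffun a => if a \in S then z.2 a (s a) else z.1 a].
suff [c' [N main]] : exists c' N : nat,
    forall (T : finType) (P : {ffun I -> T} -> Prop),
    N < #|T| -> many c P -> many c' (Q T P (enum I)).
  exists (2 * c'), N => T P NT mP.
  have T0 : 0 < #|T| by apply: leq_ltn_trans NT.
  have F0 (J : finType) : 0 < #|{ffun J -> T}| by rewrite card_ffun expn_gt0 T0.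
  have G0 : 0 < #|{ffun I -> {ffun 'I_t -> T}}| by rewrite card_ffun expn_gt0 F0.
  apply: (many_drop (F0 I) G0).
  apply: many_sub (main T P NT mP) => // z [inj sel]; split=> [a | s].
    by apply: inj; rewrite mem_enum.
  have := sel s; congr P; apply/ffunP => a.
  by rewrite !ffunE mem_enum.
elim: (enum I) => [|a S [c' [N IH]]].
  exists (c * 1), 0 => T P _ mP.
  pose P' (x : {ffun I -> T}) (Z : {ffun I -> {ffun 'I_t -> T}}) := P x.
  have : many c (fun x => many 1 (P' x)).
    by apply: many_sub mP => // x Px; apply: many_all.
  move/many_pair; apply: many_sub => // z Pz; split=> // s.
  move: Pz; congr P; apply/ffunP => b.
  by rewrite ffunE.
case: (boolP (a \in S)) => aS.
  exists c', N => T P NT mP; apply: many_sub (IH T P NT mP) => // z [inj sel].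
  have aSE b : (b \in a :: S) = (b \in S) by rewrite inE; case: eqP => // ->.
  split=> [b | s]; first by rewrite aSE; apply: inj.
  by have := sel s; congr P; apply/ffunP => b; rewrite !ffunE aSE.
exists (2 * c' * (4 * c') ^ t), (N + 4 * c' * t) => T P NT mP.
have {}IH := IH T P (leq_ltn_trans (leq_addr _ _) NT) mP.
have T0 : 0 < #|T| by apply: leq_ltn_trans NT.
have F0 : 0 < #|{ffun 'I_t -> T}| by rewrite card_ffun expn_gt0 T0.
have L1 := lens_fst {ffun I -> {ffun 'I_t -> T}} (lens_ffun T a).
have L2 := lens_snd {ffun I -> T} (lens_ffun {ffun 'I_t -> T} a).
apply/(many_lens _ _ L2 F0).
have /(many_lens _ _ L1 T0) := IH.
move/(many_blow (P := fun y z => Q T P S (put_ffun a y z.1, z.2)) T0) => /(_ t).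
have tT : 4 * c' * t <= #|T| by lia.
move=> /(_ tT); apply: many_sub => // -[X [x Z]] [/= injX sel]; split=> [b | s] /=.
  rewrite ffunE inE; case: eqP => //= _ bS.
  (* The classes built earlier do not depend on the index inside the new class, so the index 0,
     available as [0 < t], suffices. *)
  by have [+ _] := sel (Ordinal t0); apply.
have [_ /(_ s)] := sel (s a); congr P; apply/ffunP => b; rewrite !ffunE inE.
case: eqP => [-> | _] //=.
by rewrite (negbTE aS).
Qed.

(** Used to fix the order type of a configuration, which takes boundedly many values. *)
Lemma many_pigeonhole (c : nat) (T O : finType) (ty : T -> O) (P : T -> Prop) :
  0 < #|T| -> many c P ->
  exists o, many (c * #|O|) (fun x => P x /\ ty x = o).
Proof.
move=> T0 mP; apply: contrapT => noo.
have [x0 _] := many_ex T0 mP.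
have few o : c * #|O| * #|[set x | `[< P x /\ ty x = o >]]| < #|T|.
  by rewrite ltnNge; apply/negP => ?; apply: noo; exists o.
have := mP; rewrite /many => /(leq_mul (leqnn #|O|)).
have -> : #|[set x | `[< P x >]]| = \sum_o #|[set x | `[< P x /\ ty x = o >]]|.
  rewrite -sum1_card (partition_big ty xpredT) //=.
  apply: eq_bigr => o _; rewrite -sum1_card; apply: eq_bigl => x.
  rewrite !inE; apply/andP/asboolP => [[/asboolP ? /eqP ?] // | [? ?]].
  by split; [apply/asboolP | apply/eqP].
rewrite mulnA (mulnC #|O| c) big_distrr /= leqNgt => /negP; apply.
rewrite -sum_nat_const (bigD1 (ty x0)) //= [X in _ < X](bigD1 (ty x0)) //=.
by rewrite -addSn leq_add //; apply: leq_sum => o _; apply: ltnW.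
Qed.

(* Coordinates are chosen by increasing rank, [C a x y] being the condition on
   the value [y] of the coordinate [a] given the coordinates of smaller rank. *)
Lemma many_sequential (I T : finType) (c : nat) (rank : I -> nat)
    (C : I -> {ffun I -> T} -> T -> Prop) :
  0 < #|T| ->
  (forall a (x x' : {ffun I -> T}) y, (forall b, rank b < rank a -> x b = x' b) ->
    C a x y -> C a x' y) ->
  (forall a (x : {ffun I -> T}), (forall b, rank b < rank a -> C b x (x b)) -> many c (C a x)) ->
  many (c ^ #|I|) (fun x : {ffun I -> T} => forall a, C a x (x a)).
Proof.
move=> T0 loc ext.
suff main k (S : {set I}) : #|S| = k ->
    (forall a b, a \in S -> rank b < rank a -> b \in S) ->
    many (c ^ k) (fun x : {ffun I -> T} => forall a, a \in S -> C a x (x a)).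
  have := main _ [set: I] (erefl _); rewrite cardsT => /(_ (fun _ _ _ _ => in_setT _)).
  by apply: many_sub => // x Cx a; apply: Cx; rewrite inE.
elim: k S => [|k IH] S.
  move/cards0_eq => -> _; rewrite expn0; apply: many_all => x a; by rewrite inE.
move=> Sk down.
have /set0Pn[a0 a0S] : S != set0 by rewrite -card_gt0 Sk.
(* A coordinate of maximal rank is chosen last: no condition on [S] reads it except as the value
   being tested, so overwriting it spoils nothing. *)
have [a /= aS amax] : exists2 a, a \in S & forall b, b \in S -> rank b <= rank a.
  by have [a aS amax] := arg_maxnP (P := mem S) rank a0S; exists a.
have Sak : #|S :\ a| = k by have := cardsD1 a S; rewrite aS Sk => -[].
have {}IH : many (c ^ k) (fun x : {ffun I -> T} => forall b, b \in S :\ a -> C b x (x b)).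
  apply: IH => // b d; rewrite !inE => /andP[ba bS] db.
  rewrite (down b d) // andbT; apply: contraTneq db => ->.
  by rewrite -leqNgt; apply: amax.
have : many (c ^ k) (fun x : {ffun I -> T} => many c (fun y =>
    (forall b, b \in S :\ a -> C b x (x b)) /\ C a x y)).
  apply: many_sub IH => // x Cx.
  have : many c (C a x).
    apply: ext => b ba; apply: Cx; rewrite !inE (down a b) // andbT.
    by apply: contraTneq ba => ->; rewrite ltnn.
  by apply: many_sub => // y; split.
move/many_pair/many_swap; rewrite expnSr => m.
apply/(many_lens _ _ (lens_ffun T a) T0); apply: many_sub m => // -[y x] /= [Cx Cy] b bS.
have agree d : rank d < rank b -> x d = put_ffun a y x d.
  rewrite ffunE => db; case: eqP => // da; exfalso.
  by move: db; rewrite da ltnNge; have := amax b bS => ->.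
rewrite [X in C _ _ X]ffunE; case: eqP => [ba | /eqP ba].
  by rewrite ba in agree *; apply: (loc _ _ _ _ agree Cy).
by apply: (loc _ _ _ _ agree); apply: Cx; rewrite !inE ba.
Qed.

(** * Interval colourings and bottlegraphs *)

Lemma bigminn_le (J : eqType) (s : seq J) (P : pred J) (F : J -> nat) (m : nat) (j : J) :
  j \in s -> P j -> \big[minn/m]_(i <- s | P i) F i <= F j.
Proof.
elim: s => // i s IH; rewrite inE big_cons => /orP[/eqP <- -> | js Pj].
  exact: geq_minl.
case: ifP => _; last exact: IH.
by apply: leq_trans (geq_minr _ _) _; apply: IH.
Qed.

Lemma bigminn_ge (J : Type) (s : seq J) (P : pred J) (F : J -> nat) (m a : nat) :
  a <= m -> (forall i, P i -> a <= F i) -> a <= \big[minn/m]_(i <- s | P i) F i.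
Proof.
move=> am aF; elim/big_rec: _ => // i x Pi ax.
by rewrite leq_min aF.
Qed.

(** An interval colouring as the monotone map from a vertex to the index of its class;
    [interval_icol] and [icol_interval] translate between the two forms. *)
Definition icol h (H : graph h) s (c : 'I_h -> 'I_s) : Prop :=
  (forall u v : 'I_h, u < v -> c u <= c v) /\ (forall u v, H u v -> c u != c v).

Lemma icol_interval h (H : graph h) s (c : 'I_h -> 'I_s) :
  icol H c -> interval_colouring H [ffun i => [set x | c x == i]].
Proof.
move=> [mono prop]; apply/and3P; split.
- by apply/forallP => x; apply/existsP; exists (c x); rewrite ffunE inE.
- apply/forallP => i; apply/forallP => j; apply/implyP => ij.
  apply/forall_inP => a; rewrite ffunE inE => /eqP ai.
  apply/forall_inP => b; rewrite ffunE inE => /eqP bj.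
  rewrite ltnNge leq_eqVlt; apply/negP => /orP[/eqP/val_inj ba | /mono].
    by move: ij; rewrite -ai -bj ba ltnn.
  by rewrite ai bj leqNgt ij.
- apply/forallP => i; apply/forall_inP => a; rewrite ffunE inE => /eqP ai.
  apply/forall_inP => b; rewrite inE => /eqP bi.
  by apply/negP => /prop; rewrite ai bi eqxx.
Qed.

Lemma interval_icol h (H : graph h) s (V : {ffun 'I_s -> {set 'I_h}}) :
  interval_colouring H V ->
  exists2 c, icol H c & forall x i, (x \in V i) = (c x == i).
Proof.
move=> /and3P[/forallP cov /forallP ord /forallP ind].
have uni x i j : x \in V i -> x \in V j -> i = j.
  wlog ij : i j / i <= j => [W xi xj | xi xj].
    by case/orP: (leq_total i j) => ?; [| symmetry]; apply: W.
  move: ij; rewrite leq_eqVlt => /orP[/eqP/val_inj // | ij].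
  have /forallP/(_ j)/implyP/(_ ij)/forall_inP/(_ _ xi)/forall_inP/(_ _ xj) := ord i.
  by rewrite ltnn.
pose c x := xchoose (existsP (cov x)).
have cV x : x \in V (c x) := xchooseP (existsP (cov x)).
exists c; last first.
  by move=> x i; apply/idP/eqP => [/uni-/(_ _ (cV x)) -> | <-].
split=> [u v uv | u v].
  rewrite leqNgt; apply/negP => vu.
  have /forallP/(_ (c u))/implyP/(_ vu)/forall_inP/(_ _ (cV v))/forall_inP/(_ _ (cV u)) :=
    ord (c v).
  by rewrite ltnNge ltnW.
apply: contraTneq => uv.
by have /forall_inP/(_ _ (cV u))/forall_inP := ind (c u); apply; rewrite uv.
Qed.

Lemma interval_chromatic_le h (H : graph h) s (c : 'I_h -> 'I_s) :
  icol H c -> interval_chromatic H <= s.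
Proof.
move=> ic; rewrite /interval_chromatic; case: ex_minnP => r _; apply.
by apply/existsP; exists [ffun i => [set x | c x == i]]; apply: icol_interval.
Qed.

(** The form in which the absence of a barrier is used: [v] can be played by an outside vertex that
    has a class to itself and no edges to the class [j]. *)
Lemma no_barrier_icol h (H : graph h) (i j : 'I_(interval_chromatic H).+1) :
  ~ local_barrier H -> i != j ->
  exists (c : 'I_h -> 'I_(interval_chromatic H).+1) (v : 'I_h),
    [/\ icol H c, forall u, (c u == i) = (u == v)
      & forall u, H v u -> c u != j].
Proof.
move=> nb ij; apply: contrapT => no; apply: nb; exists i, j; split=> // V v iV Vi.
apply: contrapT => now; apply: no.
have [c ic cV] := interval_icol iV; exists c, v; split=> // u.
  by rewrite -cV Vi inE.
by move=> Hvu; apply/negP => cu; apply: now; exists u; rewrite ?cV.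
Qed.

Lemma rank_perm m (key : 'I_m -> nat) : injective key ->
  exists phi : {perm 'I_m}, forall x y, key x < key y -> phi x < phi y.
Proof.
move=> inj; pose S x := [set z | key z < key x].
have Sm x : #|S x| < m.
  rewrite -[X in _ < X](card_ord m) -cardsT; apply: proper_card.
  by rewrite properE subsetT; apply/subsetPn; exists x; rewrite !inE ?ltnn.
have mono x y : key x < key y -> #|S x| < #|S y|.
  move=> xy; apply: proper_card; rewrite properE; apply/andP; split.
    by apply/subsetP => z; rewrite !inE => /ltn_trans; apply.
  by apply/subsetPn; exists x; rewrite !inE ?ltnn.
pose f x : 'I_m := Ordinal (Sm x).
have finj : injective f.
  move=> x y [] fxy; apply: inj.
  by case: (ltngtP (key x) (key y)) => // /mono; rewrite fxy ltnn.
by exists (perm finj) => x y /mono; rewrite !permE.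
Qed.

Lemma card_block m t (Q : pred 'I_m) :
  #|[set a : 'I_(m * t) | Q (block a)]| = #|[set x | Q x]| * t.
Proof.
have lt (z : 'I_m * 'I_t) : z.1 * t + z.2 < m * t.
  case: z => x j /=; have : x.+1 * t <= m * t by rewrite leq_mul2r ltn_ord orbT.
  by rewrite mulSn; have := ltn_ord j; lia.
pose g z : 'I_(m * t) := Ordinal (lt z).
have gb z : block (g z) = z.1.
  apply: val_inj => /=; have tp : 0 < t by apply: leq_ltn_trans (ltn_ord z.2).
  by rewrite divnMDl // divn_small ?addn0.
have ginj : injective g.
  move=> z z' e; have e1 : z.1 = z'.1 by rewrite -!gb e.
  move: e => [] /eqP; rewrite e1 eqn_add2l => /eqP/val_inj e2.
  by case: z z' e1 e2 => [? ?] [? ?] /= -> ->.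
rewrite -[t in RHS]card_ord -cardsT -cardsX -(card_imset _ ginj).
apply: eq_card => a; rewrite inE; apply/idP/imsetP => [Qa | [z + ->]]; last first.
  by rewrite !inE gb andbT.
have tp : 0 < t by case: (t) a Qa => // -[a la]; exfalso; rewrite muln0 in la.
exists (block a, Ordinal (ltn_pmod a tp)); first by rewrite !inE Qa.
by apply: val_inj; rewrite /= -divn_eq.
Qed.

(** * Complete multipartite graphs and their critical chromatic number *)

Section Multipartite.

Variables (m : nat) (B : graph m) (k : nat) (U : 'I_k -> {set 'I_m}).
Hypothesis CM : complete_multipartite B U.

Lemma multipartite_part : exists pt : 'I_m -> 'I_k,
  [/\ forall x i, (x \in U i) = (pt x == i),
      forall x y, B x y = (pt x != pt y) & forall i, exists x, pt x = i].
Proof.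
have [ne cov dis edg] := CM.
have [pt ptU] := boolp.choice cov.
have ptE x i : (x \in U i) = (pt x == i).
  apply/idP/eqP => [xi | <- //]; apply/eqP; apply: contraT => /dis.
  by move/pred0P/(_ x); rewrite /= ptU xi.
exists pt; split=> // [x y | i]; first exact: edg.
by have /set0Pn[x] := ne i; rewrite ptE => /eqP; exists x.
Qed.

Lemma multipartite_labelling (sigma : {perm 'I_k}) :
  exists phi, interval_labelling U sigma phi.
Proof.
have [pt [ptU _ _]] := multipartite_part.
(* Lexicographic order: first the position of the part, then the vertex. *)
pose key x := sigma (pt x) * m + x.
have lt_key x y : sigma (pt x) < sigma (pt y) -> key x < key y.
  move=> xy; rewrite /key; have : (sigma (pt x)).+1 * m <= sigma (pt y) * m.
    by rewrite leq_mul2r xy orbT.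
  by rewrite mulSn; have := ltn_ord x; lia.
have inj : injective key.
  move=> x y e; have e1 : sigma (pt x) = sigma (pt y).
    apply: val_inj; case: (ltngtP (sigma (pt x)) (sigma (pt y))) => // /lt_key;
    by rewrite e ltnn.
  by move: e; rewrite /key e1 => /addnI/val_inj.
have [phi lt_phi] := rank_perm inj; exists phi => i j ij.
apply/forall_inP => _ /imsetP[x xi ->]; apply/forall_inP => _ /imsetP[y yj ->].
apply/lt_phi/lt_key; move: xi yj; rewrite !ptU => /eqP -> /eqP ->; exact: ij.
Qed.

Lemma chromatic_multipartite : chromatic B = k.
Proof.
have [pt [_ ptB surj]] := multipartite_part.
rewrite /chromatic; case: ex_minnP => r /existsP[c /forallP pc] rmin.
apply/eqP; rewrite eqn_leq rmin /=; last first.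
  apply/existsP; exists [ffun x => pt x]; apply/forallP => x; apply/forallP => y.
  by rewrite !ffunE ptB implybb.
have [rep repP] := boolp.choice surj.
have : injective (c \o rep).
  move=> i j /= e; apply/eqP; apply: contraT => ij.
  have /forallP/(_ (rep j))/implyP := pc (rep i).
  by rewrite ptB !repP e eqxx => /(_ ij).
by move/leq_card; rewrite !card_ord.
Qed.

(** Keeps the denominator of [chi_cr] positive, which is needed to clear it in [chi_cr_lt]. *)
Lemma min_colour_class_lt : 1 < k -> min_colour_class B < m.
Proof.
move=> k1; have [pt [_ ptB surj]] := multipartite_part.
have ck := chromatic_multipartite.
rewrite /min_colour_class.
pose c : {ffun 'I_m -> 'I_(chromatic B)} := [ffun x => cast_ord (esym ck) (pt x)].
have pc : proper_colouring B c.
  apply/forallP => x; apply/forallP => y; rewrite !ffunE ptB.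
  by apply/implyP; apply: contra => /eqP/cast_ord_inj ->.
apply: leq_ltn_trans (bigminn_le _ _ (mem_index_enum c) pc) _.
pose i0 : 'I_(chromatic B) := cast_ord (esym ck) (Ordinal (ltnW k1)).
apply: leq_ltn_trans (bigminn_le _ _ (mem_index_enum i0) isT) _.
have [x xi] := surj (Ordinal k1).
rewrite -[X in _ < X](card_ord m) -cardsT; apply: proper_card.
rewrite properE subsetT; apply/subsetPn; exists x; rewrite !inE //.
by rewrite ffunE xi; apply/eqP => /cast_ord_inj.
Qed.

(** Representatives of the parts use up all [k] colours, which forces every vertex to have the
    colour of its representative. So each colour class contains a whole part. *)
Lemma min_colour_class_ge (a : nat) :
  0 < k -> (forall i, a <= #|U i|) -> a <= min_colour_class B.
Proof.
move=> k0 aU; have [pt [ptU ptB surj]] := multipartite_part.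
have am : a <= m.
  apply: leq_trans (aU (Ordinal k0)) _.
  by rewrite -[X in _ <= X](card_ord m) max_card.
apply: bigminn_ge => // c /forallP pc; apply: bigminn_ge => // l _.
have [rep repP] := boolp.choice surj.
have inj : injective (c \o rep).
  move=> i j /= e; apply/eqP; apply: contraT => ij.
  have /forallP/(_ (rep j))/implyP := pc (rep i).
  by rewrite ptB !repP e eqxx => /(_ ij).
have onto l' : l' \in codom (c \o rep).
  by apply: inj_card_onto => //; rewrite !card_ord chromatic_multipartite.
have /codomP[i ->] := onto l.
apply: leq_trans (aU i) _; apply: subset_leq_card; apply/subsetP => y.
rewrite ptU inE => /eqP yi; have /codomP[i' /= e] := onto (c y).
rewrite e; apply/eqP; congr (c (rep _)); apply/eqP; apply: contraT => ii.
have /forallP/(_ (rep i'))/implyP := pc y.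
by rewrite ptB repP yi eq_sym ii e eqxx => /(_ isT).
Qed.

Lemma chi_cr_lt (R : realType) (r : nat) : 1 < k -> (chi_cr R B < r%:R)%R ->
  k.-1 * m < r * (m - min_colour_class B).
Proof.
move=> k1; have sm := min_colour_class_lt k1.
have k0 := ltnW k1.
have -> : chi_cr R B = (k.-1%:R * m%:R / (m - min_colour_class B)%:R)%R.
  by rewrite /chi_cr chromatic_multipartite -subn1 !GRing.natrB ?(ltnW sm).
rewrite Num.Theory.ltr_pdivrMr ?Num.Theory.ltr0n ?subn_gt0 // -!GRing.natrM Num.Theory.ltr_nat //.
Qed.

End Multipartite.

Lemma bottlegraph_exists h (H : graph h) : 0 < h ->
  exists m (B : graph m), bottlegraph H B.
Proof.
move=> h0.
have sym : symmetric (fun x y : 'I_h => x != y) by move=> x y; rewrite eq_sym.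
have irr : irreflexive (fun x y : 'I_h => x != y) by move=> x; rewrite eqxx.
exists h, (Graph sym irr), h, (fun i => [set i]); split=> //.
  split=> [i | x | i j ij | i j x y].
  - by apply/set0Pn; exists i; rewrite inE.
  - by exists x; rewrite inE.
  - by rewrite disjoints1 inE.
  - by rewrite !inE => /eqP -> /eqP ->.
move=> sigma phi _; exists 1 => //.
pose f (u : 'I_h) : 'I_(h * 1) := cast_ord (esym (muln1 h)) u.
have fT : [set: 'I_(h * 1)] = f @: [set: 'I_h].
  apply/setP => a; rewrite inE; apply/esym/imsetP.
  by exists (cast_ord (muln1 h) a); rewrite ?inE // /f cast_ordK.
exists [set [set: 'I_(h * 1)]].
  apply/and3P; split.
  - by rewrite /cover big_set1.
  - by apply: trivIset1.
  - by rewrite inE eq_sym; apply/set0Pn; exists (f (Ordinal h0)).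
move=> A; rewrite inE => /eqP ->; exists f; split=> // i j Hij.
rewrite /= /blowup_edge /=; apply: contraTneq Hij => /perm_inj e.
have -> : i = j by apply: val_inj; have := congr1 val e; rewrite /= !divn1.
by rewrite edge_irrefl.
Qed.

(** Double counting over the tiles, used with the constant weight 1 and with the indicator of an
    initial stretch of parts. *)
Lemma sum_tiling h n (H : graph h) (G : graph n) (P : {set {set 'I_n}})
    (S : {set 'I_n}) (E : 'I_n -> nat) (s : nat) :
  partition P S -> (forall A, A \in P -> is_copy H G A) ->
  (forall phi : 'I_h -> 'I_n, (forall i j : 'I_h, i < j -> phi i < phi j) ->
    (forall i j, H i j -> G (phi i) (phi j)) -> \sum_u E (phi u) = s) ->
  \sum_(x in S) E x = #|P| * s.
Proof.
move=> part copy sumE; rewrite (set_partition_big _ part) /=.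
rewrite -sum_nat_const; apply: eq_bigr => A /copy[phi [lt edg ->]].
rewrite big_imset /=; last first.
  move=> i j _ _ e; apply: val_inj.
  by case: (ltngtP (val i) (val j)) => // /lt; rewrite e ltnn.
rewrite -(sumE phi lt edg); apply: eq_bigl => u; by rewrite inE.
Qed.

Section Bottlegraph.

Variables (h : nat) (H : graph h) (m : nat) (B : graph m).
Variables (k : nat) (U : 'I_k -> {set 'I_m}) (pt : 'I_m -> 'I_k).
Hypothesis ptU : forall x i, (x \in U i) = (pt x == i).
Hypothesis ptB : forall x y, B x y = (pt x != pt y).

(** Parts occupy consecutive stretches in the order given by [sigma] and carry no inner edges, so
    reading off the part along a copy of [H] is an interval colouring. *)
Lemma labelling_icol (sigma : {perm 'I_k}) (phi : {perm 'I_m}) t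
    (psi : 'I_h -> 'I_(m * t)) :
  interval_labelling U sigma phi ->
  (forall i j : 'I_h, i < j -> psi i < psi j) ->
  (forall i j : 'I_h, H i j -> blowup B t phi (psi i) (psi j)) ->
  icol H (fun u => sigma (pt ((phi^-1)%g (block (psi u))))).
Proof.
move=> lab lt edg; split=> [u v uv | u v /edg].
  rewrite leqNgt; apply/negP => /lab.
  set x := (phi^-1)%g _; set y := (phi^-1)%g _.
  have yU : phi y \in phi @: U (pt y) by rewrite imset_f // ptU.
  have xU : phi x \in phi @: U (pt x) by rewrite imset_f // ptU.
  move=> /forall_inP/(_ _ xU)/forall_inP/(_ _ yU).
  rewrite !permKV /= ltnNge => /negP; apply.
  by apply: leq_div2r; apply/ltnW/lt.
by rewrite /= /blowup_edge ptB (inj_eq perm_inj).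
Qed.

(** If all interval colourings have the same cut, every tile has the same share [s / h] of its
    vertices in the first [i + 1] parts, and hence so has the whole blow-up. *)
Lemma cut_count (sigma : {perm 'I_k}) (phi : {perm 'I_m}) t (i s : nat) :
  0 < t -> interval_labelling U sigma phi ->
  has_perfect_tiling H (blowup B t phi) [set: 'I_(m * t)] ->
  (forall c : 'I_h -> 'I_k, icol H c -> #|[set u | c u <= i]| = s) ->
  h * #|[set x | sigma (pt x) <= i]| = s * m.
Proof.
move=> t0 lab [P part copy] cut.
have card_m : m * t = #|P| * h.
  rewrite -[LHS](card_ord (m * t)) -cardsT -sum1_card.
  apply: (sum_tiling part copy) => psi _ _.
  by rewrite sum1_card card_ord.
pose Q (x : 'I_m) := sigma (pt ((phi^-1)%g x)) <= i.
have card_Q : #|[set x | Q x]| * t = #|P| * s.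
  rewrite -card_block -sum1_card big_mkcond /=.
  rewrite (eq_bigl (fun a => a \in [set: 'I_(m * t)])); last by move=> a; rewrite inE.
  apply: (sum_tiling part copy) => psi lt edg.
  rewrite -(cut _ (labelling_icol lab lt edg)) -sum1_card [RHS]big_mkcond /=.
  by apply: eq_bigr => u _; rewrite !inE.
have <- : #|[set x | Q x]| = #|[set x | sigma (pt x) <= i]|.
  rewrite -(card_imset [set x | sigma (pt x) <= i] (@perm_inj _ phi)).
  apply: eq_card => y; rewrite inE; apply/idP/imsetP => [Qy | [x sx ->]].
    by exists ((phi^-1)%g y); rewrite ?permKV // inE.
  by move: sx; rewrite inE /Q permK.
apply/eqP; rewrite -(eqn_pmul2r t0) -!mulnA card_Q.
by apply/eqP; rewrite [RHS](congr1 (muln s) card_m) mulnCA [RHS]mulnCA (mulnC h).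
Qed.

End Bottlegraph.

(** A bottlegraph of critical chromatic number below [r] has exactly [r] parts, of unequal sizes. A
    constant cut would fix the total size of the first [i + 1] parts under every permutation,
    contradicting an exchange of two parts of different sizes. *)
Lemma cut_varies (R : realType) h (H : graph h) :
  1 < interval_chromatic H -> 0 < h ->
  (chi_cr_star R H < (interval_chromatic H)%:R)%R ->
  forall i, i.+1 < interval_chromatic H ->
  exists c1 c2 : 'I_h -> 'I_(interval_chromatic H),
    [/\ icol H c1, icol H c2 & #|[set u | c1 u <= i]| < #|[set u | c2 u <= i]|].
Proof.
set r := interval_chromatic H => r1 h0.
have [m0 [B0 bot0]] := bottlegraph_exists H h0.
move/(inf_lt _)=> /(_ _)[|_ [m [B [[k [U [k0 CM bot]]] ->]]] chi_lt i ir].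
  by exists (chi_cr R B0), m0, B0.
have [pt [ptU ptB surj]] := multipartite_part CM.
have tiling sigma : exists phi t, [/\ 0 < t, interval_labelling U sigma phi
    & has_perfect_tiling H (blowup B t phi) [set: 'I_(m * t)]].
  have [phi lab] := multipartite_labelling CM sigma.
  by have [t t0 til] := bot _ _ lab; exists phi, t.
have [x0 _] := surj (Ordinal k0).
have [c0 ic0] : exists c : 'I_h -> 'I_k, icol H c.
  have [phi [t [t0 lab [P part copy]]]] := tiling (perm_one 'I_k).
  have lt : x0 * t < m * t by rewrite ltn_mul2r t0 ltn_ord.
  have /bigcupP[A AP _] : Ordinal lt \in cover P by rewrite (cover_partition part) inE.
  have [psi [mono edg _]] := copy _ AP.
  exists (fun u => perm_one 'I_k (pt ((phi^-1)%g (block (psi u))))).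
  by apply: labelling_icol lab mono edg.
have rk : r <= k := interval_chromatic_le ic0.
have k1 : 1 < k := leq_trans r1 rk.
have sm := min_colour_class_lt CM k1.
have := chi_cr_lt CM k1 chi_lt; set sg := min_colour_class B in sm * => lt.
(* With more than [r] parts the critical chromatic number would be at least [k - 1 >= r]. *)
have kr : k = r.
  apply/eqP; rewrite eqn_leq rk andbT leqNgt; apply/negP => rk'.
  move: lt; rewrite ltnNge => /negP; apply.
  by apply: leq_mul; [case: (k) rk' | apply: leq_subr].
(* With all parts of equal size the critical chromatic number would be at least [k = r]. *)
have [a [b ab]] : exists a b, #|U a| != #|U b|.
  apply: contrapT => eqU.
  have allU a : #|U a| = #|U (Ordinal k0)|.
    by apply/eqP; apply: contraT => ?; case: eqU; exists a, (Ordinal k0).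
  have := min_colour_class_ge CM k0 (fun a => eq_leq (esym (allU a))).
  have : m = k * #|U (Ordinal k0)|.
    rewrite -[LHS]card_ord -[LHS]sum1_card (partition_big pt xpredT) //=.
    rewrite (eq_bigr (fun=> #|U (Ordinal k0)|)) ?sum_nat_const ?card_ord // => a _.
    by rewrite -(allU a) -sum1_card; apply: eq_bigl => x; rewrite ptU.
  rewrite -/sg => me sge.
  move: lt; rewrite ltnNge -kr => /negP; apply.
  rewrite mulnBr -subn1 mulnBl mul1n.
  by apply: leq_sub2l; rewrite {1}me leq_mul2l sge orbT.
subst k.
apply: contrapT => novar.
have cut (c : 'I_h -> 'I_r) : icol H c -> #|[set u | c u <= i]| = #|[set u | c0 u <= i]|.
  by move=> ic; case: (ltngtP #|[set u | c u <= i]| #|[set u | c0 u <= i]|) => // lt_cut;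
    exfalso; apply: novar; [exists c, c0 | exists c0, c].
have count (sigma : {perm 'I_r}) : h * #|[set x | sigma (pt x) <= i]| = #|[set u | c0 u <= i]| * m.
  by have [phi [t [t0 lab til]]] := tiling sigma; apply: (cut_count ptU ptB t0 lab til).
have {}count (s1 s2 : {perm 'I_r}) :
    #|[set x | s1 (pt x) <= i]| = #|[set x | s2 (pt x) <= i]|.
  by apply/eqP; rewrite -(eqn_pmul2l h0) !count.
have ne : a != b by apply: contraNneq ab => ->.
pose z : 'I_r := Ordinal k0.
have lk : r.-1 < r by rewrite prednK.
pose l : 'I_r := Ordinal lk.
have zl : z != l by rewrite -val_eqE /= eq_sym -lt0n -subn1 subn_gt0.
(* [s] puts [a] first and [b] last, [s'] does the opposite, and they agree on all other parts. As
   [i + 1 < r], the cut contains the first part and misses the last one. *)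
pose s1 := tperm a z.
have s1a : s1 a = z by rewrite /s1 tpermL.
have s1b : s1 b != z by rewrite -s1a (inj_eq perm_inj) eq_sym.
pose s := (s1 * tperm (s1 b) l)%g.
have sa : s a = z by rewrite /s permM s1a tpermD // eq_sym.
have sb : s b = l by rewrite /s permM tpermL.
pose s' := (tperm a b * s)%g.
have s'a : s' a = l by rewrite /s' permM tpermL sb.
have s'b : s' b = z by rewrite /s' permM tpermR sa.
pose Rest := [set x | [&& pt x != a, pt x != b & s (pt x) <= i]].
have il : (r.-1 <= i) = false by apply/negbTE; rewrite -ltnNge; lia.
have S1 : [set x | s (pt x) <= i] = U a :|: Rest.
  apply/setP => x; rewrite !inE ptU; case: eqP => [-> | _] /=; first by rewrite sa.
  by case: eqP => [-> | _] //=; rewrite sb /= il.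
have S2 : [set x | s' (pt x) <= i] = U b :|: Rest.
  apply/setP => x; rewrite !inE ptU; case: (eqVneq (pt x) b) => [-> | xb] /=.
    by rewrite s'b.
  case: (eqVneq (pt x) a) => [-> | xa] /=; first by rewrite s'a /= il.
  by rewrite /s' permM tpermD // eq_sym.
have := count s s'; rewrite S1 S2 !cardsU.
have -> : U a :&: Rest = set0.
  by apply/setP => x; rewrite !inE ptU; case: eqP.
have -> : U b :&: Rest = set0.
  by apply/setP => x; rewrite !inE ptU; case: eqP; rewrite ?andbF.
rewrite cards0 !subn0 => /eqP; rewrite eqn_add2r => /eqP e.
by rewrite e eqxx in ab.
Qed.

(* Below [v] follow [c2], above [v] follow [c1], where [v] is a vertex on
   different sides of the cut for [c1] and [c2]. *)
Lemma icol_shift h (H : graph h) r (c1 c2 : 'I_h -> 'I_r) (i j : 'I_r) :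
  j = i.+1 :> nat -> icol H c1 -> icol H c2 ->
  #|[set u | c1 u <= i]| < #|[set u | c2 u <= i]| ->
  exists (v : 'I_h) (c c' : 'I_h -> 'I_r),
    [/\ icol H c, icol H c', c v = j, c' v = i & forall u, u != v -> c' u = c u].
Proof.
move=> ji [mono1 prop1] [mono2 prop2] lt.
have : ~~ ([set u | c2 u <= i] \subset [set u | c1 u <= i]).
  by apply: contraL lt => /subset_leq_card; rewrite -leqNgt.
case/subsetPn => v; rewrite !inE -ltnNge => v2 v1.
have lo (u : 'I_h) : u <= v -> c2 u <= i.
  rewrite leq_eqVlt => /orP[/eqP/val_inj -> // | /mono2 /leq_trans]; exact.
have hi (u : 'I_h) : v <= u -> i < c1 u.
  rewrite leq_eqVlt => /orP[/eqP/val_inj <- // | /mono1]; exact: leq_trans.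
pose c x (u : 'I_h) := if u < v then c2 u else if u == v then x else c1 u.
have cv x : c x v = x by rewrite /c ltnn eqxx.
have good x : x = i \/ x = j -> icol H (c x).
  move=> xij; have x_i : i <= x <= i.+1.
    by case: xij => ->; rewrite ?ji; lia.
  split=> [u w uw | u w Huw].
    rewrite /c -!val_eqE /=.
    case: (ltngtP u v) => [uv | vu | uv]; case: (ltngtP w v) => [wv | vw | wv];
      try lia.
    - exact: mono2.
    - by have := lo u (ltnW uv); have := hi w (ltnW vw); lia.
    - by have := lo u (ltnW uv); lia.
    - exact: mono1.
    - by have := hi w (ltnW vw); lia.
  (* Neighbours of [v] below it have colour less than [c2 v <= i], and those above it colour more
     than [c1 v >= i + 1]; so both colours are free for [v]. *)
  have key u' : u' != v -> H u' v -> c x u' != x.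
    move=> uv Huv; rewrite /c (negbTE uv); case: (ltngtP u' v) => [lt_uv | lt_vu | e].
    - have := prop2 _ _ Huv; rewrite -!val_eqE /=; have := mono2 _ _ lt_uv.
      by have := lo v (leqnn _); lia.
    - have := prop1 _ _ Huv; rewrite -!val_eqE /=; have := mono1 _ _ lt_vu.
      by have := hi v (leqnn _); lia.
    - by move: uv; rewrite -val_eqE /= e eqxx.
  case: (eqVneq w v) => [wv | wv].
    rewrite wv cv; apply: key; rewrite -?wv //.
    by apply: contraTneq Huw => ->; rewrite edge_irrefl.
  case: (eqVneq u v) => [uv | uv].
    by rewrite uv cv eq_sym; apply: key; rewrite // edge_sym -uv.
  rewrite /c (negbTE wv) (negbTE uv).
  have ne (a : 'I_h) : a != v -> a != v :> nat by [].
  case: (ltngtP u v) (ne u uv) => // lu _; case: (ltngtP w v) (ne w wv) => // lw _.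
  - exact: prop2.
  - by rewrite -val_eqE; have := lo u (ltnW lu); have := hi w (ltnW lw); rewrite /=; lia.
  - by rewrite -val_eqE; have := lo w (ltnW lw); have := hi u (ltnW lu); rewrite /=; lia.
  - exact: prop1.
exists v, (c j), (c i); split=> //; [by apply: good; right | by apply: good; left |].
by move=> u uv; rewrite /c (negbTE uv).
Qed.

(** * Exchangeable vertices *)

Lemma subset_of_card (T : finType) (A : {set T}) (m : nat) :
  m <= #|A| -> exists2 B : {set T}, B \subset A & #|B| = m.
Proof.
move=> mA; exists [set x in take m (enum A)].
  apply/fintype.subsetP => x; rewrite inE => /mem_take.
  by rewrite mem_enum.
rewrite cardsE; have /card_uniqP -> : uniq (take m (enum A)) by rewrite take_uniq ?enum_uniq.
by rewrite size_takel // -cardE.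
Qed.

Lemma disjointsP (T : finType) (A B : {set T}) :
  reflect (forall x, x \in A -> x \in B -> False) [disjoint A & B].
Proof.
apply: (iffP pred0P) => [dis x xA xB | dis x].
  by have := dis x; rewrite /= xA xB.
by apply/negP => /andP[/= xA /(dis x xA)].
Qed.

Lemma nth_enum_lt n (A : {set 'I_n}) (x : 'I_n) (i j : nat) :
  i < j -> j < #|A| -> nth x (enum A) i < nth x (enum A) j.
Proof.
move=> ij jA.
have srt : sorted (fun a b : 'I_n => a < b) (enum A).
  have tr : transitive (fun a b : 'I_n => a < b) by move=> b a d; apply: ltn_trans.
  rewrite /enum_mem; apply: (sorted_filter tr).
  rewrite -enumT; have := iota_ltn_sorted 0 n.
  by rewrite -val_enum_ord sorted_map.
have tr : transitive (fun a b : 'I_n => a < b) by move=> b a d; apply: ltn_trans.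
apply: (sorted_ltn_nth tr x srt) => //; rewrite inE -cardE //.
exact: ltn_trans jA.
Qed.

(** * Assembling copies and tilings from vertex sets *)

Section Tilings.

Variables (h n : nat) (H : graph h) (G : graph n).
Hypothesis h0 : 0 < h.

Lemma copy_card A : is_copy H G A -> #|A| = h.
Proof.
move=> [phi [lt _ ->]]; rewrite card_imset ?cardsT ?card_ord // => i j e.
by apply: val_inj; case: (ltngtP (val i) (val j)) => // /lt; rewrite e ltnn.
Qed.

Lemma tiling0 : has_perfect_tiling H G set0.
Proof.
by exists set0; [rewrite partition_set0 | move=> A; rewrite inE].
Qed.

Lemma tiling_copy A : is_copy H G A -> has_perfect_tiling H G A.
Proof.
move=> cA; exists [set A] => [|B]; last by rewrite inE => /eqP ->.
rewrite /partition /cover big_set1 eqxx trivIset1 inE eq_sym /=.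
by rewrite -card_gt0 (copy_card cA).
Qed.

Lemma tilingU (S T : {set 'I_n}) : [disjoint S & T] ->
  has_perfect_tiling H G S -> has_perfect_tiling H G T ->
  has_perfect_tiling H G (S :|: T).
Proof.
move=> dis [P /and3P[/eqP cP tP nP] PH] [Q /and3P[/eqP cQ tQ nQ] QH].
exists (P :|: Q) => [|A]; last by rewrite inE => /orP[/PH | /QH].
apply/and3P; split; last by rewrite inE negb_or nP.
  by rewrite /cover bigcup_setU -!/(cover _) cP cQ.
by apply: trivIsetU => //; rewrite cP cQ.
Qed.

(** The vertex [u] goes to the element of [S (c u)] whose position is the number of vertices of the
    same colour before [u]; comparing cardinalities shows that nothing is left over. *)
Lemma copy_of_sizes s (c : 'I_h -> 'I_s) (S : 'I_s -> {set 'I_n}) :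
  (forall u v : 'I_h, u < v -> c u <= c v) ->
  (forall k l : 'I_s, k < l -> set_lt (S k) (S l)) ->
  (forall k, #|S k| = #|[set u | c u == k]|) ->
  (forall u v, H u v -> forall a b, a \in S (c u) -> b \in S (c v) -> G a b) ->
  is_copy H G (\bigcup_k S k).
Proof.
move=> mono ltS cardS edgS.
pose R (u : 'I_h) := [set v : 'I_h | (c v == c u) && (v < u)].
have rk u : #|R u| < #|S (c u)|.
  rewrite cardS; apply: proper_card; rewrite properE; apply/andP; split.
    by apply/fintype.subsetP => v; rewrite !inE => /andP[].
  by apply/subsetPn; exists u; rewrite !inE ?eqxx // ltnn andbF.
pose phi u := enum_val (Ordinal (rk u)).
have phiS u : phi u \in S (c u) by apply: enum_valP.
have phi_lt (u v : 'I_h) : u < v -> phi u < phi v.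
  move=> uv; have := mono _ _ uv; rewrite leq_eqVlt => /orP[/eqP/val_inj e | ].
    rewrite /phi !(enum_val_nth (phi u)) /= -e; apply: nth_enum_lt; last by rewrite e.
    apply: proper_card; rewrite properE; apply/andP; split.
      apply/fintype.subsetP => x; rewrite !inE e => /andP[-> /ltn_trans]; exact.
    by apply/subsetPn; exists u; rewrite !inE ?e ?eqxx ?uv // ltnn andbF.
  by move/ltS => /forall_inP/(_ _ (phiS u))/forall_inP/(_ _ (phiS v)).
have phi_inj : injective phi.
  move=> u v e; apply: val_inj.
  by case: (ltngtP (val u) (val v)) => // /phi_lt; rewrite e ltnn.
exists phi; split=> // [u v Huv | ]; first exact: (edgS _ _ Huv).
apply/esym/eqP; rewrite eqEcard; apply/andP; split.
  by apply/fintype.subsetP => _ /imsetP[u _ ->]; apply/bigcupP; exists (c u).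
rewrite card_imset // cardsT card_ord.
apply: (@leq_trans (\sum_k #|S k|)); last first.
  rewrite (eq_bigr _ (fun k _ => cardS k)).
  rewrite -[X in _ <= X]card_ord -sum1_card (partition_big c xpredT) //=.
  apply: leq_sum => k _; rewrite -sum1_card; apply: eq_leq.
  by apply: eq_bigl => u; rewrite inE.
elim/big_rec2: _ => [|k m X _ Xm]; first by rewrite cards0.
by apply: leq_trans (leq_card_setU _ _) _; rewrite leq_add2l.
Qed.

(** The sets [T] leave open just the place of [v]. One choice of [T] thus serves different vertices
    [x], the source of all exchanges. *)
Lemma copy_add s (c : 'I_h -> 'I_s) (A T : 'I_s -> {set 'I_n}) v x :
  (forall u v : 'I_h, u < v -> c u <= c v) ->
  (forall k l : 'I_s, k < l -> set_lt (A k) (A l)) ->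
  (forall u v, H u v -> forall a b, a \in A (c u) -> b \in A (c v) -> G a b) ->
  (forall k, T k \subset A k) ->
  (forall k, #|T k| = #|[set u | (c u == k) && (u != v)]|) ->
  x \in A (c v) -> x \notin \bigcup_k T k -> is_copy H G (x |: \bigcup_k T k).
Proof.
move=> mono ltA edgA TA cardT xA xT.
pose S k := if k == c v then x |: T k else T k.
have SA k a : a \in S k -> a \in A k.
  rewrite /S; case: eqP => [-> | _]; last exact: (fintype.subsetP (TA k)).
  by rewrite in_setU1 => /orP[/eqP -> // | ]; apply: (fintype.subsetP (TA _)).
have -> : x |: \bigcup_k T k = \bigcup_k S k.
  apply/setP => a; rewrite in_setU1; apply/orP/bigcupP => [[/eqP -> | ] | [k _]].
  - by exists (c v); rewrite // /S eqxx setU11.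
  - by case/bigcupP => k _ ak; exists k; rewrite // /S; case: ifP => // _; rewrite setU1r.
  - rewrite /S; case: ifP => [_ | _ ak]; last by right; apply/bigcupP; exists k.
    by rewrite in_setU1 => /orP[-> | ak]; [left | right; apply/bigcupP; exists k].
apply: (copy_of_sizes mono) => [k l kl | k | u w Huw a b].
- apply/forall_inP => a /SA aA; apply/forall_inP => b /SA bA.
  by have /forall_inP/(_ _ aA)/forall_inP/(_ _ bA) := ltA _ _ kl.
- rewrite /S; case: eqP => [-> | /eqP kv].
    rewrite cardsU1 cardT [RHS](cardsD1 v) inE eqxx.
    have -> : x \notin T (c v) by apply: contra xT => ?; apply/bigcupP; exists (c v).
    by congr (_ + _); apply: eq_card => u; rewrite !inE andbC.
  rewrite cardT; apply: eq_card => u; rewrite !inE; case: eqP => // e.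
  by apply: contraNneq kv => <-; rewrite e.
- by move=> /SA aA /SA bA; apply: edgA Huw _ _ aA bA.
Qed.

Lemma choose_classes s (c : 'I_h -> 'I_s) (A : 'I_s -> {set 'I_n}) (v : 'I_h)
    (F : {set 'I_n}) :
  (forall k, #|[set u | (c u == k) && (u != v)]| <= #|A k :\: F|) ->
  exists T : 'I_s -> {set 'I_n}, forall k,
    [/\ T k \subset A k, [disjoint T k & F]
      & #|T k| = #|[set u | (c u == k) && (u != v)]|].
Proof.
move=> sz.
have /boolp.choice[T TP] : forall k, exists T : {set 'I_n}, T \subset A k :\: F /\
    #|T| = #|[set u | (c u == k) && (u != v)]|.
  by move=> k; have [T TA Tc] := subset_of_card (sz k); exists T.
exists T => k; have [TA ->] := TP k; split=> //.
  by apply: subset_trans TA (subsetDl _ _).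
by apply/disjointsP => x /(fintype.subsetP TA); rewrite !inE => /andP[/negP].
Qed.

End Tilings.

Lemma cardsU_le (T : finType) (A B : {set T}) : #|A :|: B| <= #|A| + #|B|.
Proof. exact: leq_card_setU. Qed.

Lemma disjointUl (T : finType) (X A B : {set T}) :
  [disjoint A :|: B & X] = [disjoint A & X] && [disjoint B & X].
Proof. by rewrite -!setI_eq0 setIUl setU_eq0. Qed.

Lemma disjointUr (T : finType) (X A B : {set T}) :
  [disjoint X & A :|: B] = [disjoint X & A] && [disjoint X & B].
Proof. by rewrite -!setI_eq0 setIUr setU_eq0. Qed.

Section Reach.

Variables (h n : nat) (H : graph h) (G : graph n) (t : nat) (V : {set 'I_n}).
Hypothesis h0 : 0 < h.
Notation tiled := (has_perfect_tiling H G).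

(* [x] and [y] are exchangeable through few vertices of [V], robustly. *)
Definition reach (k : nat) (x y : 'I_n) : Prop :=
  forall F : {set 'I_n}, #|F| + k <= t -> x \in F -> y \in F ->
  exists X : {set 'I_n}, [/\ X \subset V, [disjoint X & F], #|X| <= k,
    tiled (x |: X) & tiled (y |: X)].

Lemma reach_sym k x y : reach k x y -> reach k y x.
Proof.
by move=> r F sz yF xF; have [X [XV XF Xk Xx Xy]] := r F sz xF yF; exists X.
Qed.

Lemma reach_leq k k' x y : k <= k' -> reach k x y -> reach k' x y.
Proof.
move=> kk r F sz xF yF.
have [|X [XV XF Xk Xx Xy]] := r F _ xF yF.
  by apply: leq_trans sz; rewrite leq_add2l.
by exists X; split=> //; apply: leq_trans kk.
Qed.

Lemma notin_exists (F D : {set 'I_n}) : #|F| < #|D| -> exists2 u, u \in D & u \notin F.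
Proof.
by move=> FD; apply/subsetPn; apply: contraL FD => /subset_leq_card; rewrite -leqNgt.
Qed.

Lemma tilingU1 x (X Y : {set 'I_n}) :
  [disjoint X & Y] -> x \notin Y -> tiled (x |: X) -> tiled Y -> tiled (x |: (X :|: Y)).
Proof.
move=> XY xY tX tY; rewrite setUA; apply: tilingU => //.
by rewrite disjointUl XY disjoints1 xY.
Qed.

(** With a middle vertex [u] of [D] outside [F] and disjoint exchange sets [X1] and [X2], take [X1],
    [u] and [X2] together: [u] joins [X2] when [x] is present and [X1] when [y] is. *)
Lemma reach_trans k1 k2 (D : {set 'I_n}) x y : t <= #|D| -> D \subset V ->
  (forall u, u \in D -> reach k1 x u) -> (forall u, u \in D -> reach k2 u y) ->
  reach (k1 + k2).+1 x y.
Proof.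
move=> tD DV r1 r2 F sz xF yF.
have [u uD uF] : exists2 u, u \in D & u \notin F by apply: notin_exists; lia.
have uV := fintype.subsetP DV _ uD.
have szu : #|u |: F| <= #|F|.+1 by rewrite cardsU1 uF.
have [|||X1 [X1V X1F X1k X1x X1u]] := r1 u uD (u |: F); rewrite ?setU11 ?setU1r //.
  by lia.
have szX : #|(u |: F) :|: X1| <= #|F|.+1 + k1.
  by apply: leq_trans (cardsU_le _ _) _; apply: leq_add.
have [|||X2 [X2V X2F X2k X2u X2y]] := r2 u uD ((u |: F) :|: X1).
- by lia.
- by rewrite inE setU11.
- by rewrite inE setU1r.
move: X2F; rewrite disjointUr => /andP[X2F X12].
have dF (X : {set 'I_n}) : [disjoint X & u |: F] ->
    [/\ [disjoint X & F], u \notin X, x \notin X & y \notin X].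
  rewrite disjointUr disjoint_sym disjoints1 => /andP[uX XF]; split=> //.
    by apply: contraL xF => xX; rewrite (disjointFr XF xX).
  by apply: contraL yF => yX; rewrite (disjointFr XF yX).
have [X1F' uX1 xX1 yX1] := dF _ X1F; have [X2F' uX2 xX2 yX2] := dF _ X2F.
have neq z : z \in F -> z != u by apply: contraTneq => ->.
exists (X1 :|: (u |: X2)); split.
- by rewrite !subUset X1V X2V sub1set uV.
- by rewrite !disjointUl X1F' X2F' disjoints1 uF.
- apply: leq_trans (cardsU_le _ _) _; rewrite cardsU1 uX2 -addnS.
  by apply: leq_add; rewrite //= add1n.
- apply: tilingU1 => //; first by rewrite disjointUr disjoint_sym disjoints1 uX1 disjoint_sym.
  by rewrite in_setU1 negb_or neq.
- have -> : X1 :|: (u |: X2) = X2 :|: (u |: X1) by rewrite setUCA setUC -setUA setUC -setUA setUCA.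
  apply: tilingU1 => //; first by rewrite disjointUr disjoint_sym disjoints1 uX2.
  by rewrite in_setU1 negb_or neq.
Qed.

(** Pairs off [S] with [T] and takes an exchange set for each pair, always avoiding the earlier
    ones. *)
Lemma reach_match k m (S T F : {set 'I_n}) : #|S| = m -> #|T| = m ->
  (forall x y, x \in S -> y \in T -> reach k x y) ->
  S \subset F -> T \subset F -> #|F| + m * k <= t ->
  exists Z : {set 'I_n}, [/\ Z \subset V, [disjoint Z & F], #|Z| <= m * k,
    tiled (Z :|: S) & tiled (Z :|: T)].
Proof.
elim: m S T F => [|m IH] S T F.
  move=> /cards0_eq -> /cards0_eq -> _ _ _ _; exists set0.
  by rewrite sub0set -setI_eq0 set0I eqxx cards0 !setU0; split=> //; apply: tiling0.
move=> Sm Tm r SF TF sz.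
have /set0Pn[x xS] : S != set0 by rewrite -card_gt0 Sm.
have /set0Pn[y yT] : T != set0 by rewrite -card_gt0 Tm.
have [|||X [XV XF Xk Xx Xy]] := r x y xS yT F.
- by rewrite mulSn in sz; lia.
- exact: (fintype.subsetP SF).
- exact: (fintype.subsetP TF).
have S'm : #|S :\ x| = m by have := cardsD1 x S; rewrite xS Sm => -[].
have T'm : #|T :\ y| = m by have := cardsD1 y T; rewrite yT Tm => -[].
have [|||| Z [ZV ZFX Zk ZS ZT]] := IH (S :\ x) (T :\ y) (F :|: X) S'm T'm.
- move=> a b; rewrite !inE => /andP[_ aS] /andP[_ bT]; exact: r.
- by apply: subset_trans (subsetDl _ _) _; apply: subset_trans SF (subsetUl _ _).
- by apply: subset_trans (subsetDl _ _) _; apply: subset_trans TF (subsetUl _ _).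
- by have := cardsU_le F X; rewrite mulSn in sz; lia.
move: ZFX; rewrite disjointUr => /andP[ZF ZX].
have main (A : {set 'I_n}) a : a \in A -> A \subset F -> tiled (a |: X) ->
    tiled (Z :|: A :\ a) -> tiled ((X :|: Z) :|: A).
  move=> aA AF ta tA; have -> : (X :|: Z) :|: A = (a |: X) :|: (Z :|: A :\ a).
    apply/setP => z; rewrite !inE; case: (eqVneq z a) => [-> | _]; first by rewrite aA !orbT.
    by rewrite /= orbA.
  apply: tilingU => //; apply/disjointsP => z; rewrite !inE => zX zZA.
  have aF := fintype.subsetP AF _ aA.
  case/orP: zX => [/eqP za | zX].
    move: zZA; rewrite za eqxx /= orbF => aZ.
    by rewrite (disjointFr ZF aZ) in aF.
  case/orP: zZA => [zZ | /andP[_ /(fintype.subsetP AF) zF]].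
    by rewrite (disjointFr ZX zZ) in zX.
  by rewrite (disjointFr XF zX) in zF.
exists (X :|: Z); split.
- by rewrite subUset XV ZV.
- by rewrite disjointUl XF ZF.
- by apply: leq_trans (cardsU_le _ _) _; rewrite mulSn leq_add.
- exact: main ZS.
- exact: main ZT.
Qed.

End Reach.

Lemma card_bigcup_le (I T : finType) (A : I -> {set T}) :
  #|\bigcup_i A i| <= \sum_i #|A i|.
Proof.
elim/big_rec2: _ => [|i m X _ Xm]; first by rewrite cards0.
by apply: leq_trans (cardsU_le _ _) _; rewrite leq_add2l.
Qed.

(** * Exchanges in the blow-up of a clique *)

Section Cliques.

Variables (h n : nat) (H : graph h) (G : graph n) (t : nat) (V : {set 'I_n}).
Hypothesis h0 : 0 < h.
Notation tiled := (has_perfect_tiling H G).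
Notation reach := (reach H G t V).

(** An ordered blow-up of a complete graph. The class size is bounded by the same [t] as in [reach],
    so an admissible forbidden set always leaves room. *)
Definition clique_family r (A : 'I_r -> {set 'I_n}) : Prop :=
  [/\ forall k l : 'I_r, k < l -> set_lt (A k) (A l),
      forall k l a b, k != l -> a \in A k -> b \in A l -> G a b,
      forall k, A k \subset V
    & forall k, t <= #|A k|].

Lemma complete_classes s (c : 'I_h -> 'I_s) (A T : 'I_s -> {set 'I_n}) v x (F : {set 'I_n}) :
  (forall k, T k \subset A k /\ [disjoint T k & F]) ->
  (forall k, #|T k| = #|[set u | (c u == k) && (u != v)]|) ->
  icol H c -> (forall k l : 'I_s, k < l -> set_lt (A k) (A l)) ->
  (forall u w, H u w -> forall a b, a \in A (c u) -> b \in A (c w) -> G a b) ->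
  x \in F -> x \in A (c v) -> tiled (x |: \bigcup_k T k).
Proof.
move=> TP cardT [mono _] ltA edgA xF xA.
apply: tiling_copy => //; apply: (copy_add mono ltA edgA) (cardT) xA _.
  by move=> k; have [] := TP k.
apply/negP => /bigcupP[k _ xT]; have [_ dis] := TP k.
by rewrite (disjointFr dis xT) in xF.
Qed.

Lemma bigcup_classes s (c : 'I_h -> 'I_s) (A T : 'I_s -> {set 'I_n}) (v : 'I_h)
    (F : {set 'I_n}) :
  (forall k, T k \subset A k /\ [disjoint T k & F]) ->
  (forall k, #|T k| = #|[set u | (c u == k) && (u != v)]|) ->
  [disjoint \bigcup_k T k & F] /\ #|\bigcup_k T k| <= h.
Proof.
move=> TP cardT; split.
  by rewrite disjoint_sym; apply: bigcup_disjoint => k _; rewrite disjoint_sym; case: (TP k).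
apply: leq_trans (card_bigcup_le _) _; rewrite (eq_bigr _ (fun k _ => cardT k)).
rewrite -[X in _ <= X](card_ord h) -[X in _ <= X]sum1_card.
rewrite (partition_big c xpredT) //=.
apply: leq_sum => k _; rewrite -sum1_card big_mkcond [X in _ <= X]big_mkcond.
by apply: leq_sum => u _; rewrite inE; case: eqP; case: eqP.
Qed.

Lemma cardsD_ge (A F : {set 'I_n}) (m : nat) : #|F| + m <= t -> t <= #|A| -> m <= #|A :\: F|.
Proof.
rewrite cardsD => Fm tA; have := subset_leq_card (subsetIr A F); lia.
Qed.

Lemma clique_choose r (A : 'I_r -> {set 'I_n}) (c : 'I_h -> 'I_r) (v : 'I_h)
    (F : {set 'I_n}) :
  clique_family A -> #|F| + h <= t ->
  exists T : 'I_r -> {set 'I_n},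
    (forall k, T k \subset A k /\ [disjoint T k & F]) /\
    (forall k, #|T k| = #|[set u | (c u == k) && (u != v)]|).
Proof.
move=> [_ _ _ tA] sz; have [|T TP] := @choose_classes _ _ _ c A v F.
  move=> k; apply: leq_trans (max_card _) _; rewrite card_ord.
  exact: cardsD_ge.
by exists T; split=> k; have [] := TP k.
Qed.

Lemma clique_edges r (A : 'I_r -> {set 'I_n}) (c : 'I_h -> 'I_r) :
  clique_family A -> icol H c ->
  forall u w, H u w -> forall a b, a \in A (c u) -> b \in A (c w) -> G a b.
Proof. by move=> [_ edg _ _] [_ prop] u w /prop cuw a b; apply: edg. Qed.

(** The two colourings agree off [v], so the remaining vertices of the copy can be the same for [x]
    as for [y]. *)
Lemma reach_shift r (A : 'I_r -> {set 'I_n}) (c c' : 'I_h -> 'I_r) v x y :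
  clique_family A -> icol H c -> icol H c' -> (forall u, u != v -> c' u = c u) ->
  x \in A (c v) -> y \in A (c' v) -> reach h x y.
Proof.
move=> fA ic ic' cc xA yA F sz xF yF.
have [T [TP cardT]] := clique_choose c v fA sz.
have cardT' k : #|T k| = #|[set u | (c' u == k) && (u != v)]|.
  rewrite cardT; apply: eq_card => u; rewrite !inE.
  by case: (eqVneq u v) => [_ | /cc ->]; rewrite ?andbF.
have [dis sm] := bigcup_classes TP cardT.
have [lt edg AV tA] := fA.
exists (\bigcup_k T k); split=> //.
- by apply/bigcupsP => k _; apply: subset_trans (AV k); case: (TP k).
- by apply: (complete_classes TP cardT ic lt) xF xA; apply: clique_edges.
- by apply: (complete_classes TP cardT' ic' lt) yF yA; apply: clique_edges.
Qed.

(** Exchanging within class 0 through class 1 costs [(h + h).+1], each step to the next class a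
    further [h.+1]. Two vertices are linked through class 0, whence the doubling and the middle
    vertex. *)
Definition clique_cost r := ((h + h).+1 + r * h.+1).*2.+1.

Lemma reach_clique r (A : 'I_r -> {set 'I_n}) : 1 < r ->
  (forall i j : 'I_r, j = i.+1 :> nat -> exists (v : 'I_h) (c c' : 'I_h -> 'I_r),
    [/\ icol H c, icol H c', c v = j, c' v = i & forall u, u != v -> c' u = c u]) ->
  clique_family A ->
  forall k l x y, x \in A k -> y \in A l -> reach (clique_cost r) x y.
Proof.
move=> r1 shift fA; have [lt edg AV tA] := fA.
have step (i j : 'I_r) x y : j = i.+1 :> nat -> x \in A j -> y \in A i -> reach h x y.
  move=> ij xA yA; have [v [c [c' [ic ic' cv cv' cc]]]] := shift i j ij.
  by apply: (reach_shift fA ic ic' cc); rewrite ?cv ?cv'.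
pose z : 'I_r := Ordinal (ltnW r1).
pose f d := (h + h).+1 + d * h.+1.
have from0 d : forall (k : 'I_r) x y, k = d :> nat -> x \in A z -> y \in A k -> reach (f d) x y.
  elim: d => [|d IH] k x y kd xA yA.
    have -> : f 0 = (h + h).+1 by rewrite /f addn0.
    apply: (@reach_trans _ _ _ _ _ _ h0 h h (A (Ordinal r1))) => // u uA.
      by apply/reach_sym/(step z (Ordinal r1)).
    by apply: (step k (Ordinal r1)) => //=; rewrite kd.
  have dr : d < r by have := ltn_ord k; lia.
  have -> : f d.+1 = (f d + h).+1 by rewrite /f mulSn; lia.
  apply: (@reach_trans _ _ _ _ _ _ h0 (f d) h (A (Ordinal dr))) => // u uA.
    exact: IH uA.
  by apply/reach_sym/(step (Ordinal dr) k).
have fr (k : 'I_r) : f k <= f r.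
  by rewrite /f leq_add2l leq_mul2r (ltnW (ltn_ord k)) orbT.
move=> k l x y xA yA; rewrite /clique_cost -addnn.
apply: (@reach_trans _ _ _ _ _ _ h0 (f r) (f r) (A z)) => // u uA.
  by apply: reach_sym; exact: (reach_leq (fr k) (from0 _ k _ _ (erefl _) uA xA)).
exact: (reach_leq (fr l) (from0 _ l _ _ (erefl _) uA yA)).
Qed.

Definition vertex_cost r := (h + h) + h * clique_cost r.

(** Adding [[set w]] as a class between the others gives a copy of [H] through [w]. Another copy
    passes through [y], and what remains of the two copies lies in the clique, where it is exchanged
    by [reach_match]. *)
Lemma reach_vertex r (A : 'I_r -> {set 'I_n}) (w : 'I_n) (j0 : 'I_r) :
  1 < r -> 0 < t ->
  (forall i j : 'I_r, j = i.+1 :> nat -> exists (v : 'I_h) (c c' : 'I_h -> 'I_r),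
    [/\ icol H c, icol H c', c v = j, c' v = i & forall u, u != v -> c' u = c u]) ->
  (forall i j : 'I_r.+1, i != j -> exists (c : 'I_h -> 'I_r.+1) (v : 'I_h),
    [/\ icol H c, forall u, (c u == i) = (u == v) & forall u, H v u -> c u != j]) ->
  clique_family A ->
  (forall k, k != j0 -> forall a, a \in A k -> G w a) ->
  (forall k, (forall a, a \in A k -> a < w) \/ (forall a, a \in A k -> w < a)) ->
  forall l y, y \in A l -> reach (vertex_cost r) w y.
Proof.
move=> r1 t0 shift place fA edgw cmp l y yA F sz wF yF.
have [lt edg AV tA] := fA.
(* The least such index [i0] is the place of [w] among the classes. *)
pose P i := `[< forall k : 'I_r, i <= k -> forall a, a \in A k -> w < a >].
have exP : exists i, P i.
  by exists r; apply/asboolP => k rk; have := ltn_ord k; rewrite ltnNge rk.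
have [i0 ir [above below]] : exists2 i0, i0 < r.+1 &
    (forall k : 'I_r, i0 <= k -> forall a, a \in A k -> w < a) /\
    (forall k : 'I_r, k < i0 -> forall a, a \in A k -> a < w).
  have := ex_minnP exP; case=> i0 /asboolP above i0min; exists i0.
    rewrite ltnS; apply: i0min; apply/asboolP => k rk.
    by have := ltn_ord k; rewrite ltnNge rk.
  split=> // k ki a aA; case: (cmp k) => [/(_ a aA) // | kw].
  suff /i0min : P k by rewrite leqNgt ki.
  apply/asboolP => k' kk b bA; move: kk; rewrite leq_eqVlt => /orP[/eqP/val_inj e | kk'].
    by apply: kw; rewrite e.
  apply: ltn_trans (kw a aA) _.
  by have /forall_inP/(_ _ aA)/forall_inP/(_ _ bA) := lt _ _ kk'.
pose i : 'I_r.+1 := Ordinal ir.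
pose A' k := if unlift i k is Some k' then A k' else [set w].
have A'i : A' i = [set w] by rewrite /A' unlift_none.
have A'l k : A' (lift i k) = A k by rewrite /A' liftK.
have lt' (k k' : 'I_r.+1) : k < k' -> set_lt (A' k) (A' k').
  move=> kk; apply/forall_inP => a aA; apply/forall_inP => b bA; move: kk aA bA.
  case: (unliftP i k) => [k1 ->|->]; case: (unliftP i k') => [k1' ->|->];
    rewrite ?A'i ?A'l ?inE /= /bump => kk.
  - move=> aA bA; have kk' : k1 < k1'.
      by move: kk; case: (leqP i0 k1); case: (leqP i0 k1'); rewrite /=; lia.
    by have /forall_inP/(_ _ aA)/forall_inP/(_ _ bA) := lt _ _ kk'.
  - by move=> aA /eqP ->; apply: below aA; move: kk; case: (leqP i0 k1); rewrite /=; lia.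
  - by move=> /eqP -> bA; apply: above bA; move: kk; case: (leqP i0 k1'); rewrite /=; lia.
  - lia.
(* After the insertion the exceptional class [j0] has index [lift i j0]; the vertex playing [w]
   needs no edge to it. *)
have [c [v [ic ci cj]]] := place i (lift i j0) (neq_lift _ _).
have [mono prop] := ic.
have cv : c v = i by apply/eqP; rewrite ci.
have edg' u u' : H u u' -> forall a b, a \in A' (c u) -> b \in A' (c u') -> G a b.
  have half x : H v x -> forall b, b \in A' (c x) -> G w b.
    move=> Hvx b; have := cj _ Hvx; have := prop _ _ Hvx; rewrite cv.
    case: (unliftP i (c x)) => [k ->|-> /eqP //]; rewrite A'l => _ ne bA.
    by apply: (edgw k) => //; apply: contraNneq ne => ->.
  move=> Huu a b; case: (eqVneq u v) => [e | uv].
    by rewrite e cv A'i inE => /eqP -> /(half u'); apply; rewrite -e.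
  case: (eqVneq u' v) => [e | uv'].
    rewrite e cv A'i inE => aA /eqP ->; rewrite edge_sym.
    by apply: half aA; rewrite edge_sym -e.
  have := prop _ _ Huu; move: uv uv'; rewrite -!ci.
  case: (unliftP i (c u)) => [k ->|->]; last by rewrite eqxx.
  case: (unliftP i (c u')) => [k' ->|->]; last by rewrite eqxx.
  rewrite !A'l => _ _ ne; apply: edg; by apply: contraNneq ne => ->.
have h_le : h <= vertex_cost r by rewrite /vertex_cost -addnA leq_addr.
have [|T TP] := @choose_classes _ _ _ c A' v F.
  move=> k; case: (unliftP i k) => [k' ->|->].
    rewrite A'l; apply: leq_trans (max_card _) _; rewrite card_ord.
    by apply: cardsD_ge (tA _); lia.
  suff -> : [set u | (c u == i) && (u != v)] = set0 by rewrite cards0.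
  by apply/setP => u; rewrite !inE ci andbN.
have T1 k : T k \subset A' k /\ [disjoint T k & F] by have [] := TP k.
have T2 k : #|T k| = #|[set u | (c u == k) && (u != v)]| by have [] := TP k.
have [disT sT] := bigcup_classes T1 T2.
have tT : tiled (w |: \bigcup_k T k).
  by apply: (complete_classes T1 T2 ic lt' edg') wF _; rewrite cv A'i inE.
have inA x : x \in \bigcup_k T k -> exists k, x \in A k.
  case/bigcupP => k _ xT; have [/fintype.subsetP/(_ _ xT) + _] := T1 k.
  rewrite /A'; case: unliftP => [k' _ xA | ke]; first by exists k'.
  have : #|T k| = 0.
    rewrite T2 ke; apply/eqP; rewrite cards_eq0; apply/eqP.
    by apply/setP => u; rewrite !inE ci andbN.
  by move/cards0_eq => e; rewrite e inE in xT.
set TT := \bigcup_k T k in disT sT tT inA *.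
(* Every class is used by some colouring: class 0 by a shift from class 1, any other class [l] by a
   shift to class [l - 1]. *)
have [c0 [v0 [ic0 cv0]]] : exists (c0 : 'I_h -> 'I_r) v0, icol H c0 /\ c0 v0 = l.
  case: (posnP l) => [l0 | lp].
    have [v0 [c1 [c1' [_ ic' _ cv' _]]]] := shift (Ordinal (ltnW r1)) (Ordinal r1) (erefl _).
    by exists c1', v0; split=> //; rewrite cv'; apply: val_inj; rewrite /= l0.
  have lr : l.-1 < r by have := ltn_ord l; lia.
  have [|v0 [c1 [c1' [ic' _ cv' _ _]]]] := shift (Ordinal lr) l; first by rewrite /= prednK.
  by exists c1, v0.
have [|S [S1 S2]] := clique_choose (F := F :|: TT) c0 v0 fA.
  have := cardsU_le F TT; rewrite /vertex_cost in sz; lia.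
have [disS sS] := bigcup_classes S1 S2.
have tS : tiled (y |: \bigcup_k S k).
  apply: (complete_classes S1 S2 ic0 lt); first exact: clique_edges.
    by rewrite inE yF.
  by rewrite cv0.
have inA' x : x \in \bigcup_k S k -> exists k, x \in A k.
  case/bigcupP => k _ xS; exists k.
  by have [/fintype.subsetP/(_ _ xS)] := S1 k.
set SS := \bigcup_k S k in disS sS tS inA' *.
move: disS; rewrite disjointUr => /andP[disS disST].
have cTS : #|TT| = #|SS|.
  have cT : #|w |: TT| = h.
    apply: (@copy_card _ _ H G); apply: (copy_add mono lt' edg' _ T2); rewrite ?cv ?A'i ?inE //.
      by move=> k; have [] := T1 k.
    by apply/negP => wT; rewrite (disjointFr disT wT) in wF.
  have cS : #|y |: SS| = h.
    apply: (@copy_card _ _ H G); have [mono0 _] := ic0.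
    apply: (copy_add mono0 lt (clique_edges fA ic0) _ S2); rewrite ?cv0 //.
      by move=> k; have [] := S1 k.
    by apply/negP => yS; rewrite (disjointFr disS yS) in yF.
  have wT : w \notin TT by apply/negP => wT; rewrite (disjointFr disT wT) in wF.
  have yS : y \notin SS by apply/negP => yS; rewrite (disjointFr disS yS) in yF.
  by apply/eqP; rewrite -(eqn_add2l 1); move: cT cS; rewrite !cardsU1 wT yS => -> ->.
have szF : #|F :|: TT :|: SS| <= #|F| + (h + h).
  apply: leq_trans (cardsU_le _ _) _; have := cardsU_le F TT; lia.
have TTcost : #|TT| * clique_cost r <= h * clique_cost r by rewrite leq_mul2r sT orbT.
have [||||Z [ZV ZF sZ ZT ZS]] := @reach_match _ _ H G t V h0 (clique_cost r) #|TT| TT SS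
    (F :|: TT :|: SS) (erefl _) (esym cTS).
- by move=> a b /inA[k aA] /inA'[k' bA]; apply: (reach_clique r1 shift fA aA bA).
- by rewrite -setUA setUCA subsetUl.
- by rewrite subsetUr.
- by rewrite /vertex_cost in sz; lia.
move: ZF; rewrite !disjointUr => /andP[/andP[ZF ZTT] ZSS].
have notin z (X : {set 'I_n}) : z \in F -> [disjoint X & F] -> z \notin X.
  by move=> zF XF; apply/negP => zX; rewrite (disjointFr XF zX) in zF.
exists (TT :|: (Z :|: SS)); split.
- rewrite !subUset ZV /=; apply/andP; split.
    by apply/fintype.subsetP => x /inA[k]; apply: (fintype.subsetP (AV k)).
  by apply/fintype.subsetP => x /inA'[k]; apply: (fintype.subsetP (AV k)).
- by rewrite !disjointUl disT ZF.
- apply: leq_trans (cardsU_le _ _) _; have := cardsU_le Z SS.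
  by rewrite /vertex_cost; lia.
- apply: tilingU1 => //; first by rewrite disjointUr disjoint_sym ZTT disjoint_sym.
  by apply: notin wF _; rewrite disjointUl ZF.
- have -> : TT :|: (Z :|: SS) = SS :|: (Z :|: TT) by rewrite setUC -setUA setUCA.
  apply: tilingU1 => //; first by rewrite disjointUr disjoint_sym ZSS.
  by apply: notin yF _; rewrite disjointUl ZF.
Qed.

(** Let [Y] be a copy of [H] in the clique and [Z] an exchange set between [W] and [Y]. Then [S] is
    the union of [Z] and [Y]; once [W] is added, [Z] is tiled with [W] and [Y] is a tile. *)
Lemma reach_absorber r (A : 'I_r -> {set 'I_n}) (W : {set 'I_n}) (K : nat) :
  clique_family A -> (exists c : 'I_h -> 'I_r, icol H c) -> #|W| = h ->
  (forall w k y, w \in W -> y \in A k -> reach K w y) ->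
  h + h + h.+1 + h * K <= t ->
  exists S : {set 'I_n}, [/\ S \subset V, S != set0 & absorbing H G S W].
Proof.
move=> fA [c ic] cW rW sz; have [lt edg AV tA] := fA.
pose v0 : 'I_h := Ordinal h0.
have [x xA xW] : exists2 x, x \in A (c v0) & x \notin W.
  by apply: notin_exists; have := tA (c v0); lia.
have [|T [T1 T2]] := clique_choose (F := x |: W) c v0 fA.
  by rewrite cardsU1 xW cW; lia.
have [dis sT] := bigcup_classes T1 T2.
have xT : x \notin \bigcup_k T k.
  by apply/negP => xT; move: (disjointFr dis xT); rewrite setU11.
have TA k : T k \subset A k by have [] := T1 k.
have [mono _] := ic.
have cY : is_copy H G (x |: \bigcup_k T k).
  exact: (copy_add mono lt (clique_edges fA ic) TA T2 xA).
have inA y : y \in x |: \bigcup_k T k -> exists k, y \in A k.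
  rewrite in_setU1 => /orP[/eqP -> | /bigcupP[k _ /(fintype.subsetP (TA k))]].
    by exists (c v0).
  by exists k.
set Y := x |: \bigcup_k T k in cY inA.
have YW : [disjoint Y & W].
  rewrite /Y disjointUl disjoints1 xW /=.
  by move: dis; rewrite disjointUr => /andP[].
have Yh := copy_card cY.
have [||||Z [ZV ZF _ ZW ZY]] := @reach_match _ _ H G t V h0 K h W Y (W :|: Y) cW Yh.
- by move=> w y wW /inA[k]; apply: rW.
- exact: subsetUl.
- exact: subsetUr.
- by have := cardsU_le W Y; lia.
move: ZF; rewrite disjointUr => /andP[dZW dZY].
exists (Z :|: Y); split.
- rewrite subUset ZV; apply/fintype.subsetP => y /inA[k].
  exact: (fintype.subsetP (AV k)).
- by apply/set0Pn; exists x; rewrite inE /Y setU11 orbT.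
split=> //; rewrite setUCA setUA; apply: tilingU => //; last exact: tiling_copy.
by rewrite disjointUl dZY disjoint_sym.
Qed.

End Cliques.

(** * Greedy choice of absorbers *)

Local Open Scope ring_scope.

(** At [x = u^-1] this gives [(1 - u^-1) ^+ u <= 2^-1], as used in [decay_le]. *)
Lemma bernoulli (x : rat) (u : nat) : 0 <= x <= 1 -> (1 - x) ^+ u * (1 + u%:R * x) <= 1.
Proof.
move=> /andP[x0 x1]; elim: u => [|u IH]; first by rewrite expr0 mul0r addr0 mulr1.
apply: le_trans IH; rewrite exprSr -mulrA ler_wpM2l //.
  by rewrite exprn_ge0 // subr_ge0.
have u0 : 0 <= u%:R :> rat by [].
have : 0 <= u%:R * (x * x) by rewrite mulr_ge0 ?mulr_ge0.
rewrite -natr1; have : 0 <= x * x by rewrite mulr_ge0.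
by nra.
Qed.

Lemma decay_le (u m : nat) : (0 < u)%N ->
  (1 - u%:R^-1 : rat) ^+ (u * m) <= 2^-1 ^+ m.
Proof.
move=> u0; have u0' : 0 < u%:R :> rat by rewrite ltr0n.
have x01 : 0 <= (u%:R^-1 : rat) <= 1.
  by rewrite invr_ge0 ler0n invf_le1 // ler1n.
rewrite exprM lerXn2r ?nnegrE ?invr_ge0 //.
  by rewrite exprn_ge0 // subr_ge0; case/andP: x01.
have := bernoulli u x01; rewrite mulfV ?lt0r_neq0 //; lra.
Qed.

Section Greedy.

Variables (X Wt Dt : finType) (Ws : {set Wt}) (S : Dt -> {set X}).
Variables (Q : {set X} -> Prop) (good : {set X} -> Wt -> Prop) (c k : nat).
Hypothesis goodQ : forall A W, good A W -> Q A /\ A != set0.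
Hypothesis goodS : forall W, W \in Ws -> many c (fun d => good (S d) W).
Hypothesis hitS : forall v, (#|[set d | v \in S d]| * #|X| <= k * #|Dt|)%N.
Hypothesis cardS : forall d, (#|S d| <= k)%N.
Hypotheses (X0 : (0 < #|X|)%N) (D0 : (0 < #|Dt|)%N) (c0 : (0 < c)%N) (Ws0 : Ws != set0).

Definition hits (F : {set {set X}}) W := #|[set A in F | `[< good A W >]]|.

(** Each good set chosen for [W] halves the weight of [W], so a small potential forces many hits for
    every [W]. *)
Definition potential (F : {set {set X}}) : rat := \sum_(W in Ws) 2^-1 ^+ hits F W.

Lemma card_meeting (U : {set X}) :
  (#|[set d | ~~ [disjoint S d & U]]| * #|X| <= #|U| * (k * #|Dt|))%N.
Proof.
apply: (@leq_trans ((\sum_(v in U) #|[set d | v \in S d]|) * #|X|)%N).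
  rewrite leq_mul2r; apply/orP; right.
  apply: (@leq_trans #|\bigcup_(v in U) [set d | v \in S d]|%N).
    apply: subset_leq_card; apply/fintype.subsetP => d; rewrite inE.
    case/pred0Pn => v /= /andP[vS vU]; apply/bigcupP; exists v => //.
    by rewrite inE.
  elim/big_rec2: _ => [|v m A _ Am]; first by rewrite cards0.
  by apply: leq_trans (cardsU_le _ _) _; rewrite leq_add2l.
rewrite big_distrl /= -sum_nat_const; apply: leq_sum => v _; exact: hitS.
Qed.

(** Average over the admissible choices [T]. Few choices meet the cover of [F], so for each [W] at
    least a fraction [1 / (2c)] of all choices is admissible and good; each of these halves the
    weight of [W], and the mean drops by the factor [1 - 1 / (4c)]. *)
Lemma greedy_step (F : {set {set X}}) : (2 * c * k * #|cover F| <= #|X|)%N ->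
  exists A : {set X}, [/\ Q A, A != set0, [disjoint A & cover F], (#|A| <= k)%N
    & potential (A |: F) <= (1 - (4 * c)%:R^-1) * potential F].
Proof.
move=> small.
pose T := [set d | [&& `[< Q (S d) >], S d != set0 & [disjoint S d & cover F]]].
pose TW W := [set d in T | `[< good (S d) W >]].
have big_TW W : W \in Ws -> (#|Dt| <= 2 * c * #|TW W|)%N.
  move=> WW; have gd := goodS WW; rewrite /many in gd.
  set M := [set d | ~~ [disjoint S d & cover F]].
  have sub : (#|[set d | `[< good (S d) W >]]| <= #|TW W| + #|M|)%N.
    apply: leq_trans (cardsU_le _ _); apply: subset_leq_card.
    apply/fintype.subsetP => d; rewrite !inE => gW.
    have [qd nd] := goodQ (asboolW gW).
    by rewrite gW nd; case: disjoint; rewrite ?orbT // !andbT orbF; apply/asboolP.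
  have M2 : (2 * c * #|M| <= #|Dt|)%N.
    rewrite -(leq_pmul2r X0); have := card_meeting (cover F); rewrite -/M => h1.
    have h2 := leq_mul (leqnn (2 * c)) h1.
    have h3 := leq_mul small (leqnn #|Dt|).
    by move: h2 h3; rewrite !mulnA => h2 h3; lia.
  have h4 := leq_mul (leqnn (2 * c)) sub.
  have h5 := leq_mul (leqnn 2) gd.
  by lia.
have [W0 W0W] : exists W, W \in Ws by apply/set0Pn.
have T0 : (0 < #|T|)%N.
  apply: (@leq_trans #|TW W0|); last first.
    by apply: subset_leq_card; apply/fintype.subsetP => d; rewrite inE => /andP[].
  by rewrite lt0n; apply: contraTneq (big_TW _ W0W) => ->; rewrite muln0 leqNgt D0.
(* A nonempty set disjoint from the cover is new, so a good choice raises the number of hits by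
   exactly one. *)
have TF d : d \in T -> S d \notin F.
  rewrite inE => /and3P[_ nd dis]; apply: contra nd => SF.
  rewrite -subset0; apply/fintype.subsetP => x xS.
  have := disjointFr dis xS => /negbT/negP[]; by apply/bigcupP; exists (S d).
have hitsU d W : d \in T ->
    hits (S d |: F) W = (`[< good (S d) W >] + hits F W)%N.
  move=> dT; rewrite /hits; case: asboolP => gd.
    rewrite (_ : [set A in S d |: F | _] = S d |: [set A in F | `[< good A W >]]).
      by rewrite cardsU1 inE (negbTE (TF d dT)).
    apply/setP => A; rewrite !inE; case: (eqVneq A (S d)) => [-> | _] //=.
    exact/asboolP.
  congr #|pred_of_set _|; apply/setP => A; rewrite !inE.
  case: (eqVneq A (S d)) => [-> | _] //=; rewrite (negbTE (TF d dT)) /=.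
  exact/asboolP.
pose lam : rat := 1 - (4 * c)%:R^-1.
have avg : \sum_(d in T) potential (S d |: F) <= \sum_(d in T) lam * potential F.
  rewrite sumr_const -[X in _ <= X]mulr_natl mulrA.
  rewrite /potential exchange_big /= big_distrr /=.
  apply: ler_sum => W WW; set w : rat := _ ^+ hits F W.
  have w0 : 0 <= w by rewrite exprn_ge0.
  have -> : \sum_(d in T) (2^-1 : rat) ^+ hits (S d |: F) W =
      (\sum_(d in T) (1 - 2^-1 * (`[< good (S d) W >])%:R)) * w.
    rewrite big_distrl /=; apply: eq_bigr => d dT; rewrite hitsU // exprD; congr (_ * _).
    by case: asboolP => _ /=; rewrite ?expr0 ?expr1; lra.
  rewrite ler_wpM2r // big_split /= sumr_const sumrN -mulr_sumr.
  have -> : \sum_(d in T) (`[< good (S d) W >])%:R = #|TW W|%:R :> rat.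
    rewrite -sum1_card natr_sum big_mkcond [RHS]big_mkcond /=.
    apply: eq_bigr => d _.
    have -> : (d \in TW W) = (d \in T) && `[< good (S d) W >] by rewrite inE.
    by case: (d \in T); case: `[< _ >].
  have : #|T|%:R <= (2 * c * #|TW W|)%:R :> rat.
    by rewrite ler_nat; apply: leq_trans (big_TW W WW); apply: max_card.
  have cp : 0 < c%:R :> rat by rewrite ltr0n.
  rewrite /lam !natrM; set a := #|T|%:R; set b := #|TW W|%:R => ab.
  rewrite -(ler_pM2r (x := 4 * c%:R)) ?mulr_gt0 //.
  have -> : a * (1 - (4 * c%:R)^-1) * (4 * c%:R) = a * (4 * c%:R) - a.
    by field; rewrite lt0r_neq0.
  by nra.
have [d dT le] : exists2 d, d \in T & potential (S d |: F) <= lam * potential F.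
  apply: contrapT => no; have /card_gt0P[d0 d0T] := T0.
  suff : \sum_(d in T) lam * potential F < \sum_(d in T) potential (S d |: F).
    by rewrite ltNge avg.
  apply: ltr_sum => [|d dT]; first by apply/hasP; exists d0; rewrite ?mem_index_enum.
  by rewrite ltNge; apply/negP => ?; apply: no; exists d.
move: (dT); rewrite inE => /and3P[/asboolP ? ? ?].
by exists (S d).
Qed.

Lemma greedy_family (q : nat) : (2 * c * k * (k * q) <= #|X|)%N ->
  exists F : {set {set X}}, [/\ trivIset F, forall A, A \in F -> Q A,
    (#|cover F| <= k * q)%N
    & potential F <= (1 - (4 * c)%:R^-1) ^+ q * #|Ws|%:R].
Proof.
elim: q => [_ | q IH small].
  exists set0; split.
  - by apply/trivIsetP => A B; rewrite inE.
  - by move=> A; rewrite inE.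
  - by rewrite /cover big_set0 cards0.
  - rewrite expr0 mul1r /potential (eq_bigr (fun=> 1)) ?sumr_const //.
    move=> W _; rewrite /hits (_ : [set A in set0 | _] = set0) ?cards0 //.
    by apply/setP => A; rewrite !inE.
have small' : (2 * c * k * (k * q) <= #|X|)%N.
  by apply: leq_trans small; rewrite !leq_mul2l leqnSn !orbT.
have [F [tF QF cF pF]] := IH small'.
have [|A [QA A0 dA kA pA]] := greedy_step (F := F).
  by apply: leq_trans small'; rewrite leq_mul2l cF orbT.
exists (A |: F); split.
- apply: trivIsetU => //; first exact: trivIset1.
  by rewrite /cover big_set1.
- by move=> B; rewrite in_setU1 => /orP[/eqP -> // | /QF].
- rewrite /cover bigcup_setU big_set1 mulnS.
  by apply: leq_trans (cardsU_le _ _) _; apply: leq_add.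
- apply: le_trans pA _; rewrite exprS -mulrA ler_wpM2l //.
  rewrite subr_ge0 invf_le1 ?ler1n ?ltr0n; lia.
Qed.

(** After [8cm = 4c * 2m] steps the potential is at most [2 ^ (-2m) * #|Ws| < 2 ^ (-m)], while a [W]
    with fewer than [m] hits alone would contribute at least [2 ^ (-m)]. *)
Lemma absorber_family (m : nat) : (2 * c * k * (k * (8 * c * m)) <= #|X|)%N ->
  (#|Ws| < 2 ^ m)%N ->
  exists F : {set {set X}}, [/\ trivIset F, forall A, A \in F -> Q A,
    (#|cover F| <= k * (8 * c * m))%N
    & forall W, W \in Ws -> (m <= hits F W)%N].
Proof.
move=> small WsS; have [F [tF QF cF pF]] := greedy_family small.
exists F; split=> // W WW; rewrite leqNgt; apply/negP => lt.
have : (2^-1 : rat) ^+ m <= potential F.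
  rewrite /potential (bigD1 W) //=; apply: (@le_trans _ _ (2^-1 ^+ hits F W)).
    by rewrite ler_wiXn2l // ?invr_ge0 // ltnW.
  by rewrite lerDl sumr_ge0 // => V _; rewrite exprn_ge0.
apply/negP; rewrite -ltNge; apply: le_lt_trans pF _.
have : (1 - (4 * c)%:R^-1 : rat) ^+ (8 * c * m) <= 2^-1 ^+ (2 * m).
  have -> : (8 * c * m = 4 * c * (2 * m))%N by lia.
  by apply: decay_le; lia.
move=> le1; apply: le_lt_trans (ler_wpM2r _ le1) _ => //.
rewrite mul2n -addnn exprD -mulrA -[X in _ < X]mulr1 ltr_pM2l ?exprn_gt0 //.
rewrite exprVn mulrC ltr_pdivrMr ?exprn_gt0 // mul1r -natrX ltr_nat.
exact: WsS.
Qed.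

End Greedy.
Local Close Scope ring_scope.

Lemma absorb_all h n (H : graph h) (G : graph n) (F : {set {set 'I_n}}) (l : nat)
    (W : {set 'I_n}) :
  0 < h -> trivIset F -> (forall A, A \in F -> has_perfect_tiling H G A) ->
  (forall W0 : {set 'I_n}, #|W0| = h -> l <= hits (absorbing H G) F W0) ->
  [disjoint W & cover F] -> #|W| = l * h ->
  has_perfect_tiling H G (W :|: cover F).
Proof.
move=> h0; elim: l F W => [|l IH] F W tF TF abs dW cW.
  move: cW; rewrite mul0n => /cards0_eq ->; rewrite set0U.
  have : forall P : {set {set 'I_n}}, P \subset F -> has_perfect_tiling H G (cover P).
    move=> P; move: {2}#|P| (erefl #|P|) => m; elim: m P => [|m IHm] P cP PF.
      by rewrite (cards0_eq cP) /cover big_set0; apply: tiling0.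
    have /set0Pn[A AP] : P != set0 by rewrite -card_gt0 cP.
    have PA : #|P :\ A| = m by have := cardsD1 A P; rewrite AP cP => -[].
    have AF := fintype.subsetP PF _ AP.
    have -> : cover P = A :|: cover (P :\ A) by rewrite /cover (big_setD1 A).
    apply: tilingU => //; last 2 first.
    - exact: TF.
    - by apply: IHm => //; apply: subset_trans (subsetDl _ _) PF.
    apply: bigcup_disjoint => B; rewrite !inE => /andP[BA BP].
    move/trivIsetP: tF; apply=> //; last by rewrite eq_sym.
    exact: (fintype.subsetP PF).
  exact.
have [W0 W0W cW0] : exists2 W0 : {set 'I_n}, W0 \subset W & #|W0| = h.
  by apply: subset_of_card; rewrite cW mulSn leq_addr.
have /card_gt0P[A] : 0 < hits (absorbing H G) F W0 by apply: leq_trans (abs W0 cW0).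
rewrite inE => /andP[AF /asboolP[_ tA]].
have covE : cover F = A :|: cover (F :\ A) by rewrite /cover (big_setD1 A).
have dAF : [disjoint A & cover (F :\ A)].
  apply: bigcup_disjoint => B; rewrite !inE => /andP[BA BF].
  by move/trivIsetP: tF; apply=> //; rewrite eq_sym.
move: (dW); rewrite covE disjointUr => /andP[dWA dWF].
have -> : W :|: (A :|: cover (F :\ A)) = (W0 :|: A) :|: ((W :\: W0) :|: cover (F :\ A)).
  apply/setP => x; rewrite !inE; case: (boolP (x \in W0)) => [/(fintype.subsetP W0W) -> | _] //=.
  by case: (x \in A); rewrite ?orbT.
have dD : [disjoint W :\: W0 & cover (F :\ A)].
  exact: disjointWl (subsetDl _ _) dWF.
apply: tilingU => //.
  rewrite disjointUl !disjointUr dAF (disjointWl W0W dWF) !andbT.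
  apply/andP; split; first by rewrite -setI_eq0 setDE setICA setICr setI0.
  by rewrite disjoint_sym; apply: (disjointWl (subsetDl W W0) dWA).
apply: IH => // [|B|W1 cW1|].
- apply/trivIsetP => B C; rewrite !inE => /andP[_ BF] /andP[_ CF].
  by move/trivIsetP: tF; apply.
- by rewrite inE => /andP[_ /TF].
- have := abs W1 cW1; rewrite /hits (cardsD1 A) inE AF /=.
  have -> : [set B in F | `[< absorbing H G B W1 >]] :\ A =
      [set B in F :\ A | `[< absorbing H G B W1 >]].
    by apply/setP => B; rewrite !inE andbA.
  by case: asboolP => _ /=; rewrite ?add0n ?add1n // => /ltnW.
- by have := cardsD W W0; rewrite (setIidPr W0W) cW cW0 mulSn addKn.
Qed.

(** * Configurations containing absorbers *)

Section Pattern.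

Variables (q h n : nat) (G : graph n) (w : 'I_h -> 'I_n) (K : nat).
Hypothesis q1 : 1 < q.
Hypothesis star : forall B : {set 'I_n}, #|B| <= q ->
  n <= K * #|[set y | [forall b in B, G b y]]|.

(** [inl] is the base clique, called [U] in the overview; for each [i] there follow the clique seen
    by [w i] and the clique linking that one to the base. *)
Definition pvertex : finType := ('I_q.+1 + 'I_h * ('I_q.+1 + 'I_q.+1))%type.
Definition pbase (k : 'I_q.+1) : pvertex := inl k.
Definition pown (i : 'I_h) (k : 'I_q.+1) : pvertex := inr (i, inl k).
(* The first two vertices of this clique are shared with the other two; the
   vertices [inr (i, inr k)] with [k < 2] are superfluous. *)
Definition plink (i : 'I_h) (k : 'I_q.+1) : pvertex :=
  if k == 0 :> nat then pbase ord0 else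
  if k == 1 :> nat then pown i ord0 else inr (i, inr k).

(** Earlier vertices to which [a] must be joined. The first own vertex gets an edge to the base
    because both belong to the link clique. *)
Definition pback (a : pvertex) : {set pvertex} :=
  match a with
  | inl k => [set pbase l | l : 'I_q.+1 & l < k]
  | inr (i, inl k) =>
      if k == 0 :> nat then [set pbase ord0] else [set pown i l | l : 'I_q.+1 & l < k]
  | inr (i, inr k) => [set plink i l | l : 'I_q.+1 & l < k]
  end.

(** The last own vertex already has [q] earlier neighbours, which exhausts the bound in [star]; its
    class becomes the exceptional one in [reach_vertex]. *)
Definition pexternal (a : pvertex) : {set 'I_h} :=
  if a is inr (i, inl k) then (if k < q then [set i] else set0) else set0.

Definition prank (a : pvertex) : nat :=
  match a with
  | inl k => k
  | inr (_, inl k) => q.+1 + k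
  | inr (_, inr k) => q.+1 + (q.+1 + k)
  end.

Definition pcond (a : pvertex) (x : {ffun pvertex -> 'I_n}) (y : 'I_n) : Prop :=
  [/\ forall b, b \in pback a -> G (x b) y,
      forall i, i \in pexternal a -> G (w i) y
    & forall i, y != w i].

Lemma pback_rank a b : b \in pback a -> prank b < prank a.
Proof.
case: a => [k | [i [k | k]]] /=.
- by case/imsetP => l; rewrite inE => lk ->.
- case: eqP => [k0 | _]; first by rewrite inE => /eqP ->; rewrite /= k0 addn0.
  by case/imsetP => l; rewrite inE => lk ->; rewrite /= ltn_add2l.
- case/imsetP => l; rewrite inE => lk ->; rewrite /plink; have := ltn_ord l.
  by case: ifP => _ /=; [lia | case: ifP => _ /=; lia].
Qed.

Lemma card_lt_ord (k : 'I_q.+1) (T : finType) (f : 'I_q.+1 -> T) :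
  #|[set f l | l : 'I_q.+1 & l < k]| <= k.
Proof.
apply: leq_trans (leq_imset_card _ _) _.
have inj : injective (widen_ord (ltnW (ltn_ord k))) by move=> i j [] /val_inj.
rewrite -[X in _ <= X]card_ord -(card_imset _ inj).
apply: subset_leq_card; apply/fintype.subsetP => l; rewrite inE => lk.
by apply/imsetP; exists (Ordinal lk) => //; apply: val_inj.
Qed.

(** What makes [star] applicable at every vertex. The first own vertex has two constraints, which is
    where [1 < q] enters. *)
Lemma pback_card a : #|pback a| + #|pexternal a| <= q.
Proof.
have le (k : 'I_q.+1) : k <= q by rewrite -ltnS.
case: a => [k | [i [k | k]]] /=; rewrite ?cards0 ?addn0.
- exact: leq_trans (card_lt_ord _ _) (le k).
- case: eqP => [-> | _]; first by rewrite cards1; case: ifP => _; rewrite ?cards1 ?cards0; lia.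
  have := card_lt_ord k (pown i); case: ltnP => kq; rewrite ?cards1 ?cards0; last first.
    by move=> ?; rewrite addn0; apply: leq_trans (le k).
  by move=> ?; rewrite addn1; apply: leq_ltn_trans kq.
- exact: leq_trans (card_lt_ord _ _) (le k).
Qed.

(** There are at least [n / K] common neighbours at each stage; at most [h <= n / (2K)] of them are
    excluded as values of [w]. *)
Lemma many_pcond : 0 < n -> 2 * K * h <= n ->
  many ((2 * K) ^ #|pvertex|) (fun x : {ffun pvertex -> 'I_n} => forall a, pcond a x (x a)).
Proof.
move=> n0 nK; apply: (many_sequential (rank := prank)).
- by rewrite card_ord.
- move=> a x x' y agree [c1 c2 c3]; split=> // b ba.
  by rewrite -agree ?pback_rank // c1.
move=> a x _; rewrite /many card_ord.
pose B := [set x b | b in pback a] :|: [set w i | i in pexternal a].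
have cB : #|B| <= q.
  apply: leq_trans (cardsU_le _ _) _; apply: leq_trans (pback_card a).
  by apply: leq_add; apply: leq_imset_card.
set C := [set y | _]; have sub : [set y | [forall b in B, G b y]] \subset
    C :|: [set w i | i : 'I_h].
  apply/fintype.subsetP => y; rewrite !inE => /forall_inP By.
  case: (boolP (y \in [set w i | i : 'I_h])) => yw; rewrite ?orbT // orbF.
  apply/asboolP; split=> [b bB | i iB | i].
  - by apply: By; rewrite inE imset_f.
  - by apply: By; rewrite inE orbC imset_f.
  - by apply: contraNneq yw => ->; rewrite imset_f.
have h1 := star cB; have h2 := leq_trans (subset_leq_card sub) (cardsU_le _ _).
have h3 : #|[set w i | i : 'I_h]| <= h.
  by apply: leq_trans (leq_imset_card _ _) _; rewrite card_ord.
have h4 := leq_mul (leqnn K) (leq_trans h2 (leq_add (leqnn _) h3)).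
rewrite mulnDr in h4; have h5 := leq_trans h1 h4; move: h5 nK.
by move: #|C| => z; rewrite -!mulnA; lia.
Qed.

Definition pattern (x : {ffun pvertex -> 'I_n}) : Prop :=
  [/\ forall k l, k != l -> G (x (pbase k)) (x (pbase l)),
      forall i k l, k != l -> G (x (pown i k)) (x (pown i l)),
      forall i k l, k != l -> G (x (plink i k)) (x (plink i l)),
      forall i (k : 'I_q.+1), k < q -> G (w i) (x (pown i k))
    & forall a i, x a != w i].

Lemma pcond_pattern x : (forall a, pcond a x (x a)) -> pattern x.
Proof.
move=> Cx.
have sym (f : 'I_q.+1 -> 'I_n) : (forall k l : 'I_q.+1, l < k -> G (f l) (f k)) ->
    forall k l : 'I_q.+1, k != l -> G (f k) (f l).
  move=> lt k l; rewrite -val_eqE /=; case: (ltngtP (k : nat) l) => // kl _.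
    exact: lt.
  by rewrite edge_sym; apply: lt.
split.
- apply: (sym (fun k => x (pbase k))) => k l lk; have [c _ _] := Cx (pbase k).
  by apply: c; apply: imset_f; rewrite inE.
- move=> i; apply: (sym (fun k => x (pown i k))) => k l lk.
  have [c _ _] := Cx (pown i k); apply: c => /=.
  by case: eqP lk => [-> // | _] lk; apply: imset_f; rewrite inE.
- move=> i; apply: (sym (fun k => x (plink i k))) => k l lk.
  case: (ltnP 1 k) => k1.
    have -> : plink i k = inr (i, inr k) by rewrite /plink !ifN_eq //; lia.
    have [c _ _] := Cx (inr (i, inr k)); apply: c => /=.
    by apply: imset_f; rewrite inE.
  (* Only [k = 1] and [l = 0] remain, the edge between the two shared vertices. *)
  have -> : plink i k = pown i ord0 by rewrite /plink ifN_eq ?ifT //; lia.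
  have -> : plink i l = pbase ord0 by rewrite /plink ifT //; lia.
  by have [c _ _] := Cx (pown i ord0); apply: c; rewrite /= inE.
- move=> i k kq; have [_ c _] := Cx (pown i k); apply: c.
  by rewrite /= kq inE.
- by move=> a i; have [_ _ c] := Cx a.
Qed.

Definition order_type (x : {ffun pvertex -> 'I_n}) :=
  ([ffun p : pvertex * pvertex => x p.1 < x p.2], [ffun p : pvertex * 'I_h => x p.1 < w p.2]).

(** * From a blown-up pattern to an absorber *)

Section Blowup.

Variables (H : graph h) (t : nat).
Variables (Z : {ffun pvertex -> {ffun 'I_t -> 'I_n}}).
Variable o : {ffun pvertex * pvertex -> bool} * {ffun pvertex * 'I_h -> bool}.
Hypothesis t0 : 0 < t.
Hypothesis h0 : 0 < h.
Hypothesis injZ : forall a, injective (Z a).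
Hypothesis selZ : forall s : pvertex -> 'I_t,
  pattern [ffun a => Z a (s a)] /\ order_type [ffun a => Z a (s a)] = o.

Definition part a : {set 'I_n} := [set Z a i | i : 'I_t].
Definition parts : {set 'I_n} := \bigcup_a part a.

(** Vertices of two different parts occur in a common pattern of type [o], so adjacency and order
    between parts can be read off from patterns. *)
Lemma select2 a b y z : a != b -> y \in part a -> z \in part b ->
  exists x : {ffun pvertex -> 'I_n}, [/\ pattern x, order_type x = o, x a = y & x b = z].
Proof.
move=> ab /imsetP[i _ ->] /imsetP[j _ ->].
pose s c := if c == a then i else j; have [ps os] := selZ s.
exists [ffun a => Z a (s a)]; rewrite !ffunE /s eqxx eq_sym (negbTE ab).
by split.
Qed.

(** Since the order type is fixed, two parts compare as their vertices of index 0 do; sorting the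
    parts by these gives an ordered clique blow-up. *)
Lemma clique_of_parts (f : 'I_q.+1 -> pvertex) :
  (forall x, pattern x -> forall k l, k != l -> G (x (f k)) (x (f l))) ->
  exists2 A : 'I_q.+1 -> {set 'I_n}, clique_family G t parts A &
    exists s : {perm 'I_q.+1}, forall k, A k = part (f (s k)).
Proof.
move=> adj.
have pat0 : pattern [ffun a => Z a (Ordinal t0)] by have [] := selZ (fun=> Ordinal t0).
have fne k l : k != l -> f k != f l.
  by move=> /(adj _ pat0); apply: contraTneq => ->; rewrite edge_irrefl.
have edg k l a b : k != l -> a \in part (f k) -> b \in part (f l) -> G a b.
  move=> kl aA bA; have [x [px _ <- <-]] := select2 (fne _ _ kl) aA bA.
  exact: adj.
pose key k := val (Z (f k) (Ordinal t0)).
have keyP k : Z (f k) (Ordinal t0) \in part (f k) by apply: imset_f.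
have key_inj : injective key.
  move=> k l /val_inj e; apply/eqP; apply: contraT => kl.
  by have := edg _ _ _ _ kl (keyP k) (keyP l); rewrite e edge_irrefl.
have ord k l a b : key k < key l -> a \in part (f k) -> b \in part (f l) -> a < b.
  move=> kl; have ne : k != l by apply: contraTneq kl => ->; rewrite ltnn.
  move=> aA bA; have [x [_ ox xa xb]] := select2 (fne _ _ ne) aA bA.
  have [y [_ oy ya yb]] := select2 (fne _ _ ne) (keyP k) (keyP l).
  have /(congr1 fst)/= /ffunP/(_ (f k, f l)) := etrans ox (esym oy).
  by rewrite !ffunE /= xa xb ya yb => ->.
have [phi phiP] := rank_perm key_inj.
exists (fun k => part (f ((phi^-1)%g k))); last by exists (phi^-1)%g.
split=> [k l kl | k l a b kl | k | k].
- apply/forall_inP => a aA; apply/forall_inP => b; apply: ord aA.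
  case: (ltngtP (key ((phi^-1)%g k)) (key ((phi^-1)%g l))) => // [/phiP | /key_inj/perm_inj e].
    by rewrite !permKV ltnNge ltnW.
  by move: kl; rewrite e ltnn.
- by apply: edg; rewrite (inj_eq perm_inj).
- by apply: bigcup_sup.
- by rewrite card_imset // card_ord.
Qed.

Hypothesis shift : forall i j : 'I_q.+1, j = i.+1 :> nat ->
  exists (v : 'I_h) (c c' : 'I_h -> 'I_q.+1),
    [/\ icol H c, icol H c', c v = j, c' v = i & forall u, u != v -> c' u = c u].
Hypothesis place : forall i j : 'I_q.+2, i != j ->
  exists (c : 'I_h -> 'I_q.+2) (v : 'I_h),
    [/\ icol H c, forall u, (c u == i) = (u == v) & forall u, H v u -> c u != j].

(** From [w i] to its own clique, through the link clique to the base vertex 0, then within the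
    base. *)
Definition link_cost := (vertex_cost h q.+1 + (clique_cost h q.+1 + clique_cost h q.+1).+1).+1.

Lemma card_part a : #|part a| = t.
Proof. by rewrite card_imset // card_ord. Qed.

Lemma part_sub a : part a \subset parts.
Proof. exact: bigcup_sup. Qed.

Lemma reach_parts (f : 'I_q.+1 -> pvertex) :
  (forall x, pattern x -> forall k l, k != l -> G (x (f k)) (x (f l))) ->
  forall k l x y, x \in part (f k) -> y \in part (f l) ->
  reach H G t parts (clique_cost h q.+1) x y.
Proof.
move=> /clique_of_parts[A fA [s As]] k l x y xk yl.
have r1 : 1 < q.+1 by rewrite ltnS ltnW.
apply: (reach_clique h0 r1 shift fA (k := (s^-1)%g k) (l := (s^-1)%g l)).
  by rewrite As permKV.
by rewrite As permKV.
Qed.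

Lemma reach_link i k y : y \in part (pbase k) ->
  reach H G t parts link_cost (w i) y.
Proof.
move=> yk; have r1 : 1 < q.+1 by rewrite ltnS ltnW.
pose o1 : 'I_q.+1 := Ordinal r1.
have l0 : plink i ord0 = pbase ord0 by [].
have l1 : plink i o1 = pown i ord0 by [].
apply: (reach_trans h0 (D := part (pown i ord0))); rewrite ?card_part ?part_sub // => u uD.
  have [|A fA [s As]] := @clique_of_parts (pown i).
    by move=> x [_ c _ _ _]; exact: c.
  have uA : u \in A ((s^-1)%g ord0) by rewrite As permKV.
  apply: (reach_vertex (j0 := (s^-1)%g ord_max) h0 r1 t0 shift place fA _ _ uA) => l.
    move=> ne a; rewrite As => /imsetP[j _ ->].
    have [[_ _ _ c _] _] := selZ (fun=> j).
    have lq : s l < q.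
      have : s l != ord_max by apply: contraNneq ne => <-; rewrite permK.
      by rewrite -val_eqE /= => ?; have := ltn_ord (s l); lia.
    by have := c i (s l) lq; rewrite ffunE.
  (* The order type also records the position relative to [w i], so a whole part lies on one side of
     it. *)
  have side a j : (Z a j < w i) = o.2 (a, i) /\ Z a j != w i.
    have [[_ _ _ _ c] <-] := selZ (fun=> j); rewrite /= !ffunE.
    by have := c a i; rewrite ffunE.
  case: (boolP (o.2 (pown i (s l), i))) => e; [left | right] => a;
    rewrite As => /imsetP[j _ ->]; have [lt ne] := side (pown i (s l)) j.
    by rewrite lt.
  rewrite ltn_neqAle leqNgt lt e andbT; apply: contra ne => /eqP/val_inj ->.
  exact: eqxx.
apply: (reach_trans h0 (D := part (pbase ord0))); rewrite ?card_part ?part_sub // => v vD.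
  apply: (@reach_parts (plink i) _ o1 ord0); rewrite ?l0 ?l1 //.
  by move=> x [_ _ c _ _]; apply: c.
by apply: (@reach_parts pbase _ ord0 k) => // x [].
Qed.

Lemma blowup_absorber (W : {set 'I_n}) : W = [set w i | i : 'I_h] -> #|W| = h ->
  h + h + h.+1 + h * link_cost <= t ->
  exists S : {set 'I_n}, [/\ S \subset parts, S != set0 & absorbing H G S W].
Proof.
move=> Ww cW tK; have [|A fA [s As]] := @clique_of_parts pbase; first by move=> x [].
(* Serves only to obtain some interval colouring with [q + 1] classes. *)
have [v [c [_ [ic _ _ _ _]]]] : exists (v : 'I_h) (c c' : 'I_h -> 'I_q.+1),
    [/\ icol H c, icol H c', c v = inord 1, c' v = ord0 & forall u, u != v -> c' u = c u].
  by apply: shift; rewrite inordK // ltnS ltnW.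
apply: (reach_absorber h0 fA) cW _ tK; first by exists c.
move=> x k y; rewrite Ww As => /imsetP[i _ ->]; exact: reach_link.
Qed.

End Blowup.

End Pattern.

(** * The absorbing set *)

(** With [D = C * h.+1] and [a = n %/ D] one has [n <= D * 2 ^ a], and the spare factor [2 ^ a]
    beats the constant [D ^ h]. *)
Lemma expn_lt_exp2 (h C : nat) : 0 < C ->
  exists N, forall n, N <= n -> n ^ h < 2 ^ (n %/ C).
Proof.
move=> C0; pose D := C * h.+1; have D0 : 0 < D by rewrite muln_gt0 C0.
exists (D ^ h * D) => n nD; pose a := n %/ D.
have aD : D ^ h <= a by rewrite leq_divRL.
have nle : n <= D * 2 ^ a.
  apply: ltnW; apply: leq_trans (ltn_ceil n D0) _.
  by rewrite mulnC leq_mul2l ltn_expl ?orbT.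
have an : a * h.+1 <= n %/ C.
  by rewrite leq_divRL // -mulnA (mulnC h.+1) -/D leq_trunc_div.
have powle : n ^ h <= (D * 2 ^ a) ^ h.
  by case: (posnP h) => [-> // | hp]; rewrite leq_exp2r.
apply: leq_ltn_trans powle _; apply: (@leq_trans (2 ^ (a * h.+1))); last by rewrite leq_exp2l.
rewrite expnMn mulnS expnD -expnM ltn_pmul2r ?expn_gt0 //.
by apply: leq_ltn_trans aD _; apply: ltn_expl.
Qed.

(** A candidate absorber is coded by a blown-up configuration and a selection of positions in it, so
    that the candidates form a product space. *)
Definition chosen_vertices n t (I : finType)
    (d : {ffun I -> {ffun 'I_t -> 'I_n}} * {set I * 'I_t}) : {set 'I_n} :=
  [set d.1 p.1 p.2 | p in d.2].

Lemma chosen_vertices_card n t (I : finType) d :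
  #|@chosen_vertices n t I d| <= #|I| * t.
Proof.
apply: leq_trans (leq_imset_card _ _) _; apply: leq_trans (max_card _) _.
by rewrite card_prod card_ord.
Qed.

(** Each position takes the value [v] for a [1 / n] fraction of the configurations, by [card_lens];
    then a union bound over the positions. *)
Lemma chosen_vertices_hit n t (I : finType) (v : 'I_n) :
  #|[set d | v \in @chosen_vertices n t I d]| * #|'I_n| <=
  #|I| * t * #|{: {ffun I -> {ffun 'I_t -> 'I_n}} * {set I * 'I_t}}|.
Proof.
set D := #|{: _ * _}|.
have hit (p : I * 'I_t) : #|[set d : {ffun I -> {ffun 'I_t -> 'I_n}} * {set I * 'I_t}
    | `[< d.1 p.1 p.2 = v >]]| * #|'I_n| <= D.
  have L := lens_fst {set I * 'I_t}
    (lens_comp (lens_ffun 'I_n p.2) (lens_ffun {ffun 'I_t -> 'I_n} p.1)).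
  have [gp _ _] := L.
  rewrite mulnC -(card_lens (fun d : {ffun I -> {ffun 'I_t -> 'I_n}} * {set I * 'I_t} =>
    d.1 p.1 p.2 = v) L).
  rewrite /D -(card_in_imset (f := snd) (D := [set z | _])); last first.
    move=> [y d] [y' d']; rewrite !inE => /asboolP e /asboolP e' /= dd.
    have {}e : y = v by rewrite -e; symmetry; apply: gp.
    have {}e' : y' = v by rewrite -e'; symmetry; apply: gp.
    by rewrite e e' dd.
  exact: max_card.
apply: (@leq_trans ((\sum_(p : I * 'I_t) #|[set d : {ffun I -> {ffun 'I_t -> 'I_n}} *
    {set I * 'I_t} | `[< d.1 p.1 p.2 = v >]]|) * #|'I_n|)).
  rewrite leq_mul2r; apply/orP; right; apply: leq_trans (card_bigcup_le _).
  apply: subset_leq_card; apply/fintype.subsetP => d; rewrite inE.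
  case/imsetP => p _ vp; apply/bigcupP; exists p => //; rewrite inE.
  by apply/asboolP.
have -> : #|I| * t * D = \sum_(p : I * 'I_t) D.
  by rewrite sum_nat_const card_prod card_ord.
by rewrite big_distrl; apply: leq_sum => p _; apply: hit.
Qed.

Lemma many_absorbers (q h K : nat) (H : graph h) : 0 < h -> 1 < q ->
  (forall i j : 'I_q.+1, j = i.+1 :> nat -> exists (v : 'I_h) (c c' : 'I_h -> 'I_q.+1),
    [/\ icol H c, icol H c', c v = j, c' v = i & forall u, u != v -> c' u = c u]) ->
  (forall i j : 'I_q.+2, i != j -> exists (c : 'I_h -> 'I_q.+2) (v : 'I_h),
    [/\ icol H c, forall u, (c u == i) = (u == v) & forall u, H v u -> c u != j]) ->
  exists t c N : nat, 0 < t /\ forall (n : nat) (G : graph n), N < n ->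
    (forall B : {set 'I_n}, #|B| <= q -> n <= K * #|[set y | [forall b in B, G b y]]|) ->
    forall W : {set 'I_n}, #|W| = h ->
    many c (fun d => absorbing H G (@chosen_vertices n t (pvertex q h) d) W /\
      chosen_vertices d != set0).
Proof.
move=> h0 q1 shift place.
pose t := h + h + h.+1 + h * link_cost q h.
have t0 : 0 < t by rewrite /t !addnS.
pose O := ({ffun pvertex q h * pvertex q h -> bool} * {ffun pvertex q h * 'I_h -> bool})%type.
have [c' [N' blow]] := many_blowup (pvertex q h) ((2 * K) ^ #|pvertex q h| * #|{: O}|) t0.
exists t, (c' * #|{set pvertex q h * 'I_t}|), (N' + 2 * K * h); split=> // n G nN star W cW.
pose w (i : 'I_h) : 'I_n := enum_val (cast_ord (esym cW) i).
have wW : W = [set w i | i : 'I_h].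
  apply/esym/eqP; rewrite eqEcard; apply/andP; split.
    by apply/fintype.subsetP => _ /imsetP[i _ ->]; apply: enum_valP.
  by rewrite card_imset ?card_ord ?cW // => i j /enum_val_inj/cast_ord_inj.
have n0 : 0 < n by lia.
have nK : 2 * K * h <= n by lia.
have mp := many_pcond w q1 star n0 nK.
have [|o mo] := many_pigeonhole (order_type w) _ mp.
  by rewrite card_ffun card_ord expn_gt0 n0.
have := blow _ _ _ mo; rewrite card_ord => /(_ (leq_ltn_trans (leq_addr _ _) nN)) mZ.
apply: (@many_pair c' #|{set pvertex q h * 'I_t}| _ _ (fun Z J =>
  absorbing H G (@chosen_vertices n t (pvertex q h) (Z, J)) W /\
  chosen_vertices (Z, J) != set0)).
apply: many_sub mZ => // Z [injZ selZ].
have [S [SV S0 abs]] : exists S : {set 'I_n},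
    [/\ S \subset parts Z, S != set0 & absorbing H G S W].
  apply: (blowup_absorber (w := w) (o := o) q1 t0 h0 injZ _ shift place wW cW (leqnn t)).
  by move=> s; have [pc oc] := selZ s; split=> //; apply: pcond_pattern.
have SE : chosen_vertices (Z, [set p | Z p.1 p.2 \in S]) = S.
  apply/setP => y; apply/imsetP/idP => [[p + ->] | yS]; first by rewrite inE.
  have /bigcupP[a _ /imsetP[i _ ya]] := fintype.subsetP SV _ yS.
  by exists (a, i); rewrite ?inE /= -?ya.
(* One good selection per configuration is enough, as the number of selections does not depend on
   [n]. *)
apply: leq_pmulr; rewrite card_gt0; apply/set0Pn; exists [set p | Z p.1 p.2 \in S].
by rewrite inE; apply/asboolP; rewrite SE.
Qed.

(** * The degree condition and the choice of constants *)

Local Open Scope ring_scope.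

(** Each vertex has at most [(1/q - eta) n] non-neighbours, so [q] vertices still leave
    [q * eta * n >= n / K] common neighbours. *)
Lemma common_neighbours (R : realType) (q n K : nat) (G : graph n) (eta : R) :
  (0 < q)%N -> (0 < K)%N -> 0 < eta -> 1 <= K%:R * eta ->
  (1 - q%:R^-1 + eta) * n%:R <= (min_degree G)%:R ->
  forall B : {set 'I_n}, (#|B| <= q)%N ->
  (n <= K * #|[set y | [forall b in B, G b y]]|)%N.
Proof.
move=> q0 K0 eta0 Keta deg B Bq.
pose x : R := (q%:R^-1 - eta) * n%:R.
pose non v := ~: [set y | G v y].
have non_le v : #|non v|%:R <= x.
  have := cardsC [set y | G v y]; rewrite card_ord -/(non v) => e.
  have : (min_degree G <= #|[set y | G v y]|)%N.
    exact: (bigminn_le (fun u => #|[set y | G u y]|) n (mem_index_enum v)).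
  rewrite -(ler_nat R) => le; have := congr1 (fun m => m%:R : R) e; rewrite natrD => e'.
  by rewrite /x; nra.
set N := [set y | _].
have nN : n%:R <= #|N|%:R + #|B|%:R * x.
  have sub : (#|~: N| <= \sum_(b in B) #|non b|)%N.
    apply: (@leq_trans #|\bigcup_(b in B) non b|%N).
      apply: subset_leq_card; apply/fintype.subsetP => y; rewrite !inE.
      rewrite negb_forall => /existsP[b]; rewrite negb_imply => /andP[bB nb].
      by apply/bigcupP; exists b => //; rewrite !inE.
    elim/big_rec2: _ => [|b m A _ Am]; first by rewrite cards0.
    by apply: leq_trans (cardsU_le _ _) _; rewrite leq_add2l.
  have : #|~: N|%:R <= #|B|%:R * x.
    apply: (@le_trans _ _ (\sum_(b in B) #|non b|)%:R); first by rewrite ler_nat.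
    rewrite natr_sum mulr_natl -sumr_const.
    by apply: ler_sum => b _; apply: non_le.
  have := cardsC N; rewrite card_ord => e; have := congr1 (fun m => m%:R : R) e.
  rewrite natrD; lra.
rewrite -(ler_nat R) natrM.
have q0' : 0 < q%:R :> R by rewrite ltr0n.
have K1 : 1 <= K%:R :> R by rewrite ler1n.
have n0 : 0 <= n%:R :> R by [].
(* An empty [B] is treated apart, because the sign of [x] is known only from a vertex of [B]. *)
have [/cards0_eq B0 | ] := posnP #|B|.
  move: nN; rewrite B0 cards0 mul0r addr0; have : 0 <= #|N|%:R :> R by [].
  nra.
case/card_gt0P => b bB.
have x0 : 0 <= x by apply: le_trans (non_le b).
have Bx : #|B|%:R * x <= q%:R * x by rewrite ler_wpM2r // ler_nat.
have qx : q%:R * x = n%:R - q%:R * eta * n%:R.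
  by rewrite /x; field; rewrite lt0r_neq0.
have etaN : eta * n%:R <= #|N|%:R.
  have : 0 <= (q%:R - 1) * (eta * n%:R) by rewrite !mulr_ge0 ?subr_ge0 ?ler1n // ltW.
  lra.
apply: (@le_trans _ _ (K%:R * (eta * n%:R))); last by rewrite ler_wpM2l.
by rewrite mulrA -[X in X <= _]mul1r ler_wpM2r.
Qed.
Local Close Scope ring_scope.

Theorem theorem4p2 (R : realType) (h : nat) (H : graph h) (eta : R) :
  2 < interval_chromatic H ->
  (0 < eta)%R ->
  ~ local_barrier H ->
  (chi_cr_star R H < (interval_chromatic H)%:R)%R ->
  exists (n0 : nat) (nu : R),
    (0 < nu < eta)%R /\
    forall (n : nat) (G : graph n),
      n0 <= n ->
      ((1 - ((interval_chromatic H)%:R - 1)^-1 + eta) * n%:R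
         <= (min_degree G)%:R :> R)%R ->
      exists Abs : {set 'I_n},
        (#|Abs|%:R <= nu * n%:R)%R /\
        forall W : {set 'I_n},
          W \subset ~: Abs ->
          h %| #|W| ->
          (#|W|%:R <= nu ^+ 3 * n%:R)%R ->
          absorbing H G Abs W.
Proof.
move=> r2 eta0 nb chi.
(* Giving every vertex its own class shows that the interval chromatic number is at most [h]. *)
have h0 : 0 < h.
  have id_icol : icol H id.
    split=> [u v /ltnW // | u v]; by apply: contraTneq => ->; rewrite edge_irrefl.
  exact: leq_trans (ltnW (ltnW r2)) (interval_chromatic_le id_icol).
have shift (i j : 'I_(interval_chromatic H)) : j = i.+1 :> nat ->
    exists (v : 'I_h) (c c' : 'I_h -> 'I_(interval_chromatic H)),
    [/\ icol H c, icol H c', c v = j, c' v = i & forall u, u != v -> c' u = c u].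
  move=> ji; have ir : i.+1 < interval_chromatic H by rewrite -ji.
  have [c1 [c2 [ic1 ic2 lt]]] := cut_varies (ltnW r2) h0 chi ir.
  exact: icol_shift ji ic1 ic2 lt.
have place (i j : 'I_(interval_chromatic H).+1) := @no_barrier_icol h H i j nb.
move: shift place; clear chi nb; case: (interval_chromatic H) r2 => // q q1 shift place.
have q0 : 0 < q by apply: ltnW.
pose K := Num.bound eta^-1.
have eK : (eta^-1 < K%:R)%R by apply: archi_boundP; rewrite invr_ge0 ltW.
have Keta : (1 < K%:R * eta)%R by rewrite -ltr_pdivrMr // mul1r.
have K0 : 0 < K by rewrite -(ltr0n R); apply: lt_trans eK; rewrite invr_gt0.
have [t [c0 [N [t0 absN]]]] := many_absorbers K h0 q1 shift place.
(* [c0] is for the density of absorbers, [K] for [nu < eta], and 4 for the final comparison with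
   [nu ^+ 3]; [k] bounds the size of an absorber. *)
pose c := c0 + K + 4; pose k := #|pvertex q h| * t.
have k0 : 0 < k.
  rewrite muln_gt0 t0 andbT; apply/card_gt0P; exists (pbase h (ord0 : 'I_q.+1)).
  by [].
have c4 : 4 <= c by rewrite leq_addl.
have c_gt0 : 0 < c by apply: leq_trans c4.
have ck : c <= 2 * c * k.
  by have := leq_mul (leq_mul (isT : 1 <= 2) (leqnn c)) k0; rewrite mul1n muln1.
(* With [nu = 1 / (2ck)] this is [4 / nu ^+ 2]: for [m = n %/ C] the [8cm] absorbers cover at most
   [nu * n] vertices. *)
pose C := 2 * c * k * (k * (8 * c)).
have ck_gt0 : 0 < 2 * c * k := leq_trans c_gt0 ck.
have C0 : 0 < C by rewrite /C (muln_gt0 (2 * c * k)) ck_gt0 (muln_gt0 k) k0 (muln_gt0 8).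
have [N2 expN] := expn_lt_exp2 h C0.
have ck0 : (0 < (2 * c * k)%:R :> R)%R by rewrite ltr0n.
(* [N] provides the absorbers, [N2] gives [n ^ h < 2 ^ m], and [h] ensures that some set of size [h]
   exists. *)
exists (N + N2 + h).+1, ((2 * c * k)%:R^-1)%R; split.
  rewrite invr_gt0 ck0 /= -[X in (X < _)%R]mul1r ltr_pdivrMr // mulrC.
  apply: lt_le_trans Keta _; rewrite ler_wpM2r ?(ltW eta0) // ler_nat.
  by apply: leq_trans ck; rewrite /c; lia.
move=> n G nN deg.
have n_gt0 : 0 < n by apply: leq_trans nN.
have star : forall B : {set 'I_n}, #|B| <= q -> n <= K * #|[set y | [forall b in B, G b y]]|.
  apply: (common_neighbours q0 K0 eta0 (ltW Keta)).
  by move: deg; rewrite -natr1 addrK.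
have manyW (W : {set 'I_n}) : W \in [set W : {set 'I_n} | #|W| == h] ->
    many c (fun d => absorbing H G (@chosen_vertices n t (pvertex q h) d) W /\
      chosen_vertices d != set0).
  rewrite inE => /eqP cW; have nN' : N < n by lia.
  by apply: many_sub (absN n G nN' star W cW) => //; rewrite /c; lia.
pose m := n %/ C.
have mC : m * C <= n by apply: leq_trunc_div.
pose Dt := ({ffun pvertex q h -> {ffun 'I_t -> 'I_n}} * {set pvertex q h * 'I_t})%type.
have [|||||||F [tF TF cF hitF]] := @absorber_family 'I_n {set 'I_n} Dt
  [set W : {set 'I_n} | #|W| == h] (@chosen_vertices n t (pvertex q h))
  (has_perfect_tiling H G) (fun A W => absorbing H G A W /\ A != set0) c k _ manyW
  (@chosen_vertices_hit n t (pvertex q h)) (@chosen_vertices_card n t (pvertex q h)) _ _ _ _ m.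
- by move=> A W [[]].
- by rewrite card_ord.
- have F0 : 0 < #|{ffun 'I_t -> 'I_n}| by rewrite card_ffun !card_ord expn_gt0 n_gt0.
  rewrite card_prod muln_gt0 card_ffun expn_gt0 F0 /=.
  by apply/card_gt0P; exists set0.
- by [].
- have hn : h <= #|[set: 'I_n]| by rewrite cardsT card_ord; lia.
  have [W _ cW] := subset_of_card hn; apply/set0Pn; exists W.
  by rewrite inE cW.
- rewrite card_ord; apply: leq_trans mC; rewrite /C; apply: eq_leq; lia.
- have nN2 : N2 <= n by lia.
  rewrite card_draws card_ord; apply: leq_ltn_trans (expN n nN2).
  apply: (@leq_trans (n ^_ h)); first by rewrite -bin_ffact leq_pmulr ?fact_gt0.
  rewrite ffact_prod -[X in _ <= _ ^ X]card_ord -prod_nat_const.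
  by apply: leq_prod => i _; apply: leq_subr.
have absF l (W0 : {set 'I_n}) : l <= m -> #|W0| = h -> l <= hits (absorbing H G) F W0.
  move=> lm cW0; apply: leq_trans lm _; apply: leq_trans (hitF W0 _) _.
    by rewrite inE cW0.
  apply: subset_leq_card; apply/fintype.subsetP => A; rewrite !inE.
  by move=> /andP[-> /asboolP[? _]]; apply/asboolP.
exists (cover F); split.
  rewrite mulrC ler_pdivlMr // -natrM ler_nat.
  apply: leq_trans mC; apply: leq_trans (leq_mul cF (leqnn _)) _.
  rewrite /C; apply: eq_leq; lia.
move=> W WF hW Wn; split.
  (* That the absorbing set itself is tiled is the case of an empty [W]. *)
  have := @absorb_all h n H G F 0 set0 h0 tF TF; rewrite set0U; apply.
  - by move=> W0; apply: absF.
  - by rewrite -setI_eq0 set0I.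
  - by rewrite cards0.
have dWF : [disjoint W & cover F] by move: WF; rewrite subsets_disjoint setCK.
case/dvdnP: hW => l Wl.
apply: (absorb_all h0 tF TF (l := l)) => // W0; apply: absF.
rewrite leq_divRL //.
have WnN : #|W| * (2 * c * k) ^ 3 <= n.
  rewrite -(ler_nat R) natrM natrX -ler_pdivlMr ?exprn_gt0 //.
  by rewrite mulrC -exprVn.
apply: leq_trans WnN; apply: leq_mul; first by rewrite Wl leq_pmulr.
(* The number of pieces of [W] is at most [nu ^+ 3 * n], which is at most [n / C] because
   [2ck >= 4]. *)
have -> : C = (2 * c * k) ^ 2 * 4 by rewrite /C expnS expn1; lia.
rewrite (expnSr _ 2) leq_mul2l; apply/orP; right.
exact: leq_trans c4 ck.
Qed.
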